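(* For all partitions $\mu,\nu$, $$\sum_{\lambda} G^{\beta}_{\lambda /\!\!/ \mu}(\mathbf{x})\, g^{\beta}_{\lambda/\nu}(\mathbf{y}) = \prod_{i,j}\frac{1}{1 - x_iy_j} \sum_{\kappa} G^{\beta}_{\nu/\!\!/ \kappa}(\mathbf{x})\, g^{\beta}_{\mu/\kappa}(\mathbf{y}),$$ where $\mathbf{x}=(x_1,x_2,\ldots)$, $\mathbf{y}=(y_1,y_2,\ldots)$ and the sums run over all partitions.
   Context: Partitions $\lambda=(\lambda_1\ge\lambda_2\ge\cdots)$ (finitely many nonzero parts) are identified with Young diagrams $\{(i,j):1\le j\le\lambda_i\}$ (row $i$, column $j$). Let $\beta$ be a scalar parameter and $\mathbb{Z}[\beta]P$ the free $\mathbb{Z}[\beta]$-module with basis all partitions, with bilinear pairing $\langle\lambda,\mu\rangle=\delta_{\lambda\mu}$. For $i\ge1$, the Schur operators $u_i,d_i$ are linear: $u_i\cdot\lambda$ is the partition obtained by adding a box in column $i$ if the result is a partition, and $0$ otherwise; $d_i\cdot\lambda$ is obtained by removing a box from column $i$ if the result is a partition, and $0$ otherwise. Set $\widetilde u_i=u_i(1-\beta d_i)$ and $\widetilde d_i=(1-\beta d_i)^{-1}d_i=\sum_{k\ge1}\beta^{k-1}d_i^k$. For a central variable $x$ let $A(x)=\cdots(1+x\widetilde u_2)(1+x\widetilde u_1)$ and $B(x)=(1+x\widetilde d_1)(1+x\widetilde d_2)\cdots$. Define $G^\beta_{\lambda/\!\!/\mu}(x_1,\dots,x_n)=\langle A(x_n)\cdots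 A(x_1)\cdot\mu,\lambda\rangle$ and $g^\beta_{\lambda/\mu}(x_1,\dots,x_n)=\langle B(x_n)\cdots B(x_1)\cdot\lambda,\mu\rangle$; these are symmetric polynomials, stable under setting $x_n=0$, and hence define symmetric functions (formal power series) in infinitely many variables $\mathbf{x}=(x_1,x_2,\ldots)$. *)

(* Defs.v *)
From HB Require Import structures.
From mathcomp Require Import all_boot all_order all_algebra finmap zify.
From mathcomp Require Import boolp classical_sets fsbigop.
From mathcomp.multinomials Require Import monalg.

Set Implicit Arguments.
Unset Strict Implicit.
Unset Printing Implicit Defensive.

Import GRing.Theory.

Definition is_part (s : seq nat) : bool :=
  sorted geq s && (0 \notin s).

Record part : Type := Part { parts :> seq nat; _ : is_part parts }.
HB.instance Definition _ := [isSub for parts].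
HB.instance Definition _ := [Choice of part by <:].

(* Rows and columns are numbered from 1. *)
Definition in_diagram (la : part) (i j : nat) : bool :=
  [&& 0 < i, 0 < j & j <= nth 0 la i.-1].

Definition box_added (i j : nat) (la mu : part) :=
  ~~ in_diagram la i j /\
  forall r c, in_diagram mu r c = in_diagram la r c || ((r, c) == (i, j)).

Definition col_len (la : part) (j : nat) : nat :=
  count (leq j) la.

(* The only cell of column j that may be added is (h + 1, j), where h is the
   height of column j; the result is a diagram iff row h + 1 (at index h) has
   length j - 1. *)
Definition add_box (j : nat) (la : part) : option part :=
  let h := col_len la j in
  if (nth 0 la h).+1 == j then insub (incr_nth la h) else None.

(* The only cell of column j that may be removed is (h, j); the result is a
   diagram iff row h (at index h - 1) has length j. The filter drops the row
   if it became empty. *)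
Definition rem_box (j : nat) (la : part) : option part :=
  let h := col_len la j in
  if (0 < h) && (nth 0 la h.-1 == j)
  then insub [seq r <- set_nth 0 la h.-1 j.-1 | 0 < r] else None.

Lemma geq_trans : transitive geq.
Proof. by move=> y x z /= xy yz; apply: leq_trans yz xy. Qed.

Lemma leq_nth_count (s : seq nat) (j i : nat) :
  sorted geq s -> 0 < j -> (j <= nth 0 s i) = (i < count (leq j) s).
Proof.
move=> + j0; elim: s i => [|a s IH] i srt /=; first by rewrite nth_nil; lia.
have {}IH k := IH k (path_sorted srt).
move: srt; rewrite /= (path_sortedE geq_trans) => /andP[/allP al _].
case: (leqP j a) => ja.
  by case: i => [|i] /=; rewrite ?ja ?IH //; lia.
have c0 : count (leq j) s = 0.
  apply/eqP; rewrite -leqn0 leqNgt -has_count; apply/hasPn => x /al /=; lia.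
by case: i => [|i] /=; [lia | rewrite IH c0; lia].
Qed.

Lemma part_ext (la mu : part) : (forall k, nth 0 la k = nth 0 mu k) -> la = mu.
Proof.
have sz (a b : part) : (forall k, nth 0 a k = nth 0 b k) -> size a <= size b.
  move=> e; rewrite leqNgt; apply/negP => lt.
  have := e (size b); rewrite (nth_default _ (leqnn _)) => ea.
  by case: a lt ea {e} => s /= /andP[_ /negP n0] lt e0; apply: n0; rewrite -e0 mem_nth.
move=> e; apply: val_inj; apply: (@eq_from_nth _ 0) => //.
by apply/eqP; rewrite eqn_leq !sz.
Qed.

Lemma part_nth_le (la : part) i k : i <= k -> nth 0 la k <= nth 0 la i.
Proof.
case: la => s /= /andP[srt _] ik; case: (posnP (nth 0 s k)) => [->//|n0].
by rewrite leq_nth_count // (leq_ltn_trans ik) // -leq_nth_count.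
Qed.

Lemma is_part_nth (s : seq nat) :
  (forall k, nth 0 s k.+1 <= nth 0 s k) -> is_part [seq r <- s | 0 < r] /\
  (forall k, nth 0 [seq r <- s | 0 < r] k = nth 0 s k).
Proof.
elim: s => [|a s IH] d; first by split.
have {IH} [/andP[IH1 IH2] IHn] := IH (fun k => d k.+1).
have ds k : nth 0 s k <= a.
  by elim: k => [|k IHk]; [exact: (d 0)|apply: leq_trans IHk; exact: (d k.+1)].
rewrite /=; case: (posnP a) => a0 /=.
  split; first by rewrite /is_part IH1 IH2.
  by move=> k; rewrite IHn; case: k => [|k] /=; [move: (ds 0)|move: (ds k) (ds k.+1)]; lia.
split; last by case=> [|k] /=.
rewrite /is_part /= in_cons negb_or IH2 andbT (path_sortedE geq_trans) IH1 andbT.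
rewrite eq_sym -lt0n a0 andbT.
by apply/allP => x; rewrite mem_filter => /andP[_] /(nthP 0)[k _ <-] /=; exact: ds.
Qed.

Lemma box_addedP (i j : nat) (la mu : part) : box_added i j la mu <->
  [/\ 0 < i, nth 0 la i.-1 = j.-1, 0 < j &
      forall k, nth 0 mu k = nth 0 la k + (i.-1 == k)].
Proof.
rewrite /box_added /in_diagram; split=> [[nd e]|[i0 lj j0 e]]; last first.
  split; first by rewrite i0 j0 lj; lia.
  move=> r c; rewrite e xpair_eqE; case: (posnP r) => [->|r0] /=; first by lia.
  case: (posnP c) => [->|c0] /=; first by lia.
  by case: eqP => [ir|ne]; [rewrite -ir lj|]; lia.
have := e i j; rewrite eqxx orbT => /and3P[i0 j0 jm].
move: nd; rewrite i0 j0 /= -ltnNge => lj.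
have ek k c : 0 < c -> (c <= nth 0 mu k) = (c <= nth 0 la k) || ((k.+1 == i) && (c == j)).
  by move=> c0; have := e k.+1 c; rewrite c0 xpair_eqE.
have lj' : nth 0 la i.-1 = j.-1.
  case: (ltnP 1 j) => j1; last by lia.
  by have := ek i.-1 j.-1; lia.
split=> // k; case: eqP => [<-|ne].
  have := ek i.-1 j.+1 isT; rewrite prednK // lj'; lia.
apply/eqP; rewrite addn0 eqn_leq; apply/andP; split.
  by case: (posnP (nth 0 mu k)) => [->//|c0]; have := ek k _ c0; lia.
by case: (posnP (nth 0 la k)) => [->//|c0]; have := ek k _ c0; lia.
Qed.

Lemma add_boxP j la mu : add_box j la = Some mu <-> exists i, box_added i j la mu.
Proof.
rewrite /add_box; split.
  case: eqP => // hj; case: insubP => // v _ ev [<-].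
  exists (col_len la j).+1; apply/box_addedP; split => //=; [by rewrite -[in RHS]hj|by rewrite -hj|].
  by move=> k; rewrite -[nth 0 v k]/(nth 0 (val v) k) ev nth_incr_nth addnC.
case=> i /box_addedP[i0 lj j0 e].
have h : col_len la j = i.-1.
  have c k := @leq_nth_count la j k (proj1 (andP (valP la))) j0.
  have := c i.-1; rewrite lj => c1.
  case: (ltnP 1 i) => i1; last by rewrite /col_len; lia.
  have := c i.-2; have := @part_nth_le mu i.-2 i.-1 ltac:(lia).
  rewrite !e lj eqxx /= ; rewrite /col_len; case: eqP; lia.
rewrite h lj prednK // eqxx.
have -> : incr_nth la i.-1 = val mu.
  have /is_part_nth[] : forall k, nth 0 (incr_nth la i.-1) k.+1 <= nth 0 (incr_nth la i.-1) k.
    by move=> k; rewrite !nth_incr_nth ![(_ == _) + _]addnC -!e part_nth_le.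
  have -> : [seq r <- incr_nth la i.-1 | 0 < r] = incr_nth la i.-1.
    apply/all_filterP/(all_nthP 0) => k; rewrite size_incr_nth nth_incr_nth.
    case: (i.-1 =P k) => //= ik; case: ifP => ils kk.
      have /negP n0 := proj2 (andP (valP la)).
      by rewrite lt0n; apply/eqP => z; apply: n0; rewrite -z mem_nth.
    have kk' : k < i.-1 by lia.
    have := @part_nth_le mu k i.-1 (ltnW kk'); rewrite !e eqxx lj; case: eqP; lia.
  move=> ip _; rewrite -[LHS]/(val (Part ip)); congr val.
  by apply: part_ext => k /=; rewrite nth_incr_nth e addnC.
by rewrite valK.
Qed.

Lemma rem_boxP j la mu : rem_box j la = Some mu <-> exists i, box_added i j mu la.
Proof.
rewrite /rem_box; split.
  case: ifP => // /andP[h0 /eqP hj].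
  case: (posnP j) => [j0|j0].
    move: h0 hj; rewrite j0 /col_len.
    have -> : count (leq 0) la = size la by rewrite -[RHS](count_predT).
    move=> s0 z; case/negP: (proj2 (andP (valP la))).
    by rewrite -z mem_nth // prednK.
  set s := set_nth _ _ _ _; case: insubP => // v _ ev [<-].
  have c k := @leq_nth_count la j k (proj1 (andP (valP la))) j0.
  have ns k : nth 0 s k = nth 0 la k - (k == (col_len la j).-1).
    by rewrite nth_set_nth /=; case: eqP => [->|_]; rewrite ?hj; lia.
  have /is_part_nth[_ en] : forall k, nth 0 s k.+1 <= nth 0 s k.
    move=> k; rewrite !ns; have := @part_nth_le la k k.+1 (leqnSn _).
    have := c k.+1; have := c k; rewrite /col_len in h0 hj *.
    case: (k.+1 =P _) => [e1|_]; case: (k =P _) => [e2|_]; try lia.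
  exists (col_len la j); apply/box_addedP; split => //.
    by rewrite -[nth 0 v _]/(nth 0 (val v) _) ev en ns eqxx hj; lia.
  move=> k; rewrite -[nth 0 v _]/(nth 0 (val v) _) ev en ns eq_sym.
  by case: eqP => [<-|_]; rewrite ?hj; lia.
case=> i /box_addedP[i0 lj j0 e].
have lj' : nth 0 la i.-1 = j by rewrite e lj eqxx; lia.
have h : col_len la j = i.
  have c k := @leq_nth_count la j k (proj1 (andP (valP la))) j0.
  have := c i.-1; rewrite lj' => c1; have := c i.
  have := @part_nth_le mu i.-1 i ltac:(lia).
  rewrite !e lj /col_len in c1 *; case: eqP; lia.
rewrite h i0 lj' eqxx /=; set s := set_nth _ _ _ _.
have ns k : nth 0 s k = nth 0 mu k.
  by rewrite nth_set_nth /= e eq_sym; case: eqP => [<-|_]; lia.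
have /is_part_nth[ip en] : forall k, nth 0 s k.+1 <= nth 0 s k.
  by move=> k; rewrite !ns part_nth_le.
rewrite insubT; congr Some; apply: part_ext => k.
by rewrite -ns -en.
Qed.

Local Open Scope classical_set_scope.
Local Open Scope ring_scope.

Notation Zbeta := {poly int}.

(* Monomials in the two families of variables x_0, x_1, ... (indices inl i)
   and y_0, y_1, ... (indices inr j). *)
Notation mon := {cmonom (nat + nat)%type}.

Notation pol := {malg Zbeta[mon]}.

Definition beta : pol := ('X : Zbeta)%:MP.
Definition xvar (i : nat) : pol := << (ucm (inl i) : mon) >>.
Definition yvar (j : nat) : pol := << (ucm (inr j) : mon) >>.

(* Z[beta]P with scalars extended to Z[beta][x, y], the variables being
   central. The pairing of v with the basis element la is v@_la. *)
Notation Pmod := {malg pol[part]}.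

Definition basis (la : part) : Pmod := << la >>.

Definition linext (f : part -> Pmod) (v : Pmod) : Pmod :=
  \sum_(la <- msupp v) v@_la *: f la.

Definition u_op (i : nat) : Pmod -> Pmod :=
  linext (fun la => oapp basis 0 (add_box i la)).

Definition d_op (i : nat) : Pmod -> Pmod :=
  linext (fun la => oapp basis 0 (rem_box i la)).

Definition ut_op (i : nat) (v : Pmod) : Pmod := u_op i (v - beta *: d_op i v).

(* d_i^k kills la as soon as k exceeds the height of column i of la, so that
   this is the whole series over k >= 1. *)
Definition dt_op (i : nat) : Pmod -> Pmod :=
  linext (fun la =>
    \sum_(1 <= k < (col_len la i).+1) beta ^+ k.-1 *: iter k (d_op i) (basis la)).

(* (1 + x ut_N) ... (1 + x ut_2) (1 + x ut_1), ut_1 acting first *)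
Definition A_trunc (N : nat) (x : pol) (v : Pmod) : Pmod :=
  foldl (fun w i => w + x *: ut_op i w) v (iota 1 N).

(* (1 + x dt_1) (1 + x dt_2) ... (1 + x dt_N), dt_N acting first *)
Definition B_trunc (N : nat) (x : pol) (v : Pmod) : Pmod :=
  foldr (fun i w => w + x *: dt_op i w) v (iota 1 N).

(* The value of an eventually constant sequence (0 for other sequences). *)
Definition evlim (T : nmodType) (s : nat -> T) : T :=
  xget 0 [set l | exists N, forall n, (N <= n)%N -> s n = l].

(* G_{la//mu}(z_0, ..., z_{n-1}) and g_{la/mu}(z_0, ..., z_{n-1}).
   A(z) mu is in general an infinite combination of partitions, each of whose
   coefficients is determined by finitely many factors of A(z): the factors
   1 + z ut_i with i larger than the first part of la do not contribute to the
   coefficient of la. The matrix coefficients of products of the infinite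
   products A and B are thus eventual values of those of their truncations. *)
Definition G_fin (n : nat) (z : nat -> pol) (la mu : part) : pol :=
  evlim (fun N => (foldl (fun w i => A_trunc N (z i) w) (basis mu) (iota 0 n))@_la).

Definition g_fin (n : nat) (z : nat -> pol) (la mu : part) : pol :=
  evlim (fun N => (foldl (fun w i => B_trunc N (z i) w) (basis la) (iota 0 n))@_mu).

(* Z[beta][[x, y]]: formal power series, given by their coefficients *)
Definition series : Type := mon -> Zbeta.

Definition sone : series := fun m => (1 : pol)@_m.

Definition smul (f g : series) : series :=
  fun m => \sum_(p \in [set p : mon * mon | mmul p.1 p.2 = m]) f p.1 * g p.2.

(* Coefficientwise sum of a family, every coefficient of which is nonzero for
   only finitely many members of the family. *)
Definition ssum (T : choiceType) (F : T -> series) : series :=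
  fun m => \sum_(t \in [set: T]) F t m.

Definition slim (F : nat -> series) : series := fun m => evlim (fun n => F n m).

Definition series_of (p : pol) : series := fun m => p@_m.

Definition G_sym (z : nat -> pol) (la mu : part) : series :=
  slim (fun n => series_of (G_fin n z la mu)).

Definition g_sym (z : nat -> pol) (la mu : part) : series :=
  slim (fun n => series_of (g_fin n z la mu)).

(* 1 / (1 - p), for p without constant term *)
Definition geom (p : pol) : series := ssum (fun k : nat => series_of (p ^+ k)).

(* prod_{i, j} 1 / (1 - x_i y_j) *)
Definition cauchy_kernel : series :=
  slim (fun N =>
    \big[smul/sone]_(i < N) \big[smul/sone]_(j < N) geom (xvar i * yvar j)).

(* Main.v *)
(** Both sides are the matrix coefficient between mu and nu of a product of the
    operators A(x_i) and B(y_j), so it suffices that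
    (1 - x y) B(y) A(x) = A(x) B(y). In terms of column heights B(y) changes
    the columns independently of each other, and A(x) only couples neighbouring
    columns. Hence the matrix coefficients of B(y) A(x) and of A(x) B(y) are
    computed by transfer recursions along the columns, and these satisfy the
    required relation up to the term in which a box is added to every column
    up to the truncation bound N. From a partition with l columns this takes
    N - l factors x. So on vectors whose coefficient at la has order at least
    la_1 - M, a property that A and B preserve, A and B commute up to
    1 - x y and terms of order N - M. To compare the coefficients of a given
    monomial m, take N large and work with polynomials up to agreement on the
    divisors of m. *)

From HB Require Import structures.
From mathcomp Require Import all_boot all_order all_algebra finmap zify ring.
From mathcomp Require Import boolp classical_sets fsbigop.
From mathcomp.multinomials Require Import monalg.
Require Import Defs.

Set Implicit Arguments.
Unset Strict Implicit.
Unset Printing Implicit Defensive.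

Import GRing.Theory.
Local Open Scope ring_scope.

(** * The transfer recursion *)

Definition noninc (a : nat -> nat) := forall i, (a i.+1 <= a i)%N.

Definition shift (a : nat -> nat) : nat -> nat := fun i => a i.+1.

Lemma noninc_shift a : noninc a -> noninc (shift a).
Proof. by move=> h i; apply: h. Qed.

Lemma noninc_le a i j : noninc a -> (i <= j)%N -> (a j <= a i)%N.
Proof. by move=> h /subnK <-; elim: (j - i)%N => // k; apply: leq_trans (h _). Qed.

Section Transfer.
Context (R : comNzRingType) (bt x y : R).

(* The coefficient of 1 + y dt_i for lowering column i from height a to b. *)
Definition wdown (a b : nat) : R :=
  if (a < b)%N then 0 else if a == b then 1 else y * bt ^+ (a - b).-1.

Lemma wdown_lt a b : (a < b)%N -> wdown a b = 0.
Proof. by rewrite /wdown => ->. Qed.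

Lemma wdown_eq a : wdown a a = 1.
Proof. by rewrite /wdown ltnn eqxx. Qed.

(** The right side mentions no weight except [wdown a b], so once the heights are ordered [ring] can
    settle the identities below. The last case is the passage from weight 0 to weight 1 at
    [b = a.+1]. *)
Lemma wdownS a b : wdown a.+1 b =
  if (b < a)%N then bt * wdown a b else if a == b then y else (a.+1 == b)%:R.
Proof.
rewrite /wdown; case: (ltngtP a b) => [ab|ba|->].
- by case: (ltngtP a.+1 b) => //; lia.
- have -> : (a.+1 < b)%N = false by lia.
  have -> : (a.+1 == b) = false by lia.
  have -> : (a.+1 - b).-1 = (a - b).-1.+1 by lia.
  by rewrite exprS; ring.
- have -> : (b.+1 < b)%N = false by lia.
  have -> : (b.+1 == b) = false by lia.
  by rewrite subSnn expr0 mulr1.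
Qed.

(** The weight depends only on the difference of the heights. This links [down_up], which lowers the
    target, to [up_down], which raises the source. *)
Lemma wdown_pred a b : (0 < b)%N -> wdown a b.-1 = wdown a.+1 b.
Proof. by case: b => // b _; rewrite /wdown ltnS eqSS subSS. Qed.

(* Here a and b are the column heights of the partitions indexing a matrix
   coefficient of B(y) A(x), restricted to n consecutive columns. The sum runs
   over the column heights c_i in {a_i, a_i + 1} of the intermediate partition;
   t is the value of c in the column preceding the n given ones. *)
Fixpoint up_down n (a b : nat -> nat) (t : nat) : R :=
  if n is n'.+1 then
    (1 - bt * x * (a 1%N < a 0%N)%:R) * wdown (a 0%N) (b 0%N)
      * up_down n' (shift a) (shift b) (a 0%N)
    + (a 0%N < t)%:R * x * wdown (a 0%N).+1 (b 0%N)
      * up_down n' (shift a) (shift b) (a 0%N).+1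
  else 1.

(* The error caused by truncating after n columns: the terms of up_down whose
   last column is nonempty, times x y. *)
Fixpoint overflow n (a b : nat -> nat) (t : nat) : R :=
  if n is n'.+1 then
    (1 - bt * x * (a 1%N < a 0%N)%:R) * wdown (a 0%N) (b 0%N)
      * overflow n' (shift a) (shift b) (a 0%N)
    + (a 0%N < t)%:R * x * wdown (a 0%N).+1 (b 0%N)
      * overflow n' (shift a) (shift b) (a 0%N).+1
  else x * y * (0 < t)%:R.

(* The same for A(x) B(y): the intermediate column heights are e_i in
   {b_i, b_i - 1}, and the two components collect the terms with e_0 = b_0 and
   with e_0 = b_0 - 1. *)
Fixpoint down_up n (a b : nat -> nat) : R * R :=
  if n is n'.+1 then
    let: (s, d) := down_up n' (shift a) (shift b) in
    (wdown (a 0%N) (b 0%N)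
       * (if (b 1%N < b 0%N)%N then (1 - bt * x) * (s + d) else s + d - bt * x * d),
     (0 < b 0%N)%:R * x * wdown (a 0%N) (b 0%N).-1
       * (if (b 1%N < b 0%N)%N then s + d else d))
  else (1, 0).

Definition down_up_sum n a b := (down_up n a b).1 + (down_up n a b).2.

Lemma down_up_sumS n a b : down_up_sum n.+1 a b =
  wdown (a 0%N) (b 0%N)
    * (if (b 1%N < b 0%N)%N then (1 - bt * x) * down_up_sum n (shift a) (shift b)
      else down_up_sum n (shift a) (shift b) - bt * x * (down_up n (shift a) (shift b)).2)
  + (0 < b 0%N)%:R * x * wdown (a 0%N) (b 0%N).-1
      * (if (b 1%N < b 0%N)%N then down_up_sum n (shift a) (shift b)
         else (down_up n (shift a) (shift b)).2).
Proof. by rewrite /down_up_sum /=; case: (down_up n _ _) => s d /=. Qed.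

Lemma down_up2S n a b : (down_up n.+1 a b).2 =
  (0 < b 0%N)%:R * x * wdown (a 0%N) (b 0%N).-1
      * (if (b 1%N < b 0%N)%N then down_up_sum n (shift a) (shift b)
         else (down_up n (shift a) (shift b)).2).
Proof. by rewrite /down_up_sum /=; case: (down_up n _ _) => s d /=. Qed.

Lemma down_up2_eq0 n a b : b 0%N = 0%N -> (down_up n a b).2 = 0.
Proof. by case: n => // n b0; rewrite down_up2S b0 !mul0r. Qed.

(** This is what the induction in [up_down_overflow] needs from the terms leaving column 0
    unchanged; the terms that add a box there account for the subtracted product on the right. The
    proof is a finite check over the relative order of the first heights. *)
Lemma down_up_step n a b : noninc a -> noninc b ->
  (forall i, n < i -> a i = 0)%N -> (forall i, n < i -> b i = 0)%N ->
  (1 - bt * x * (a 1%N < a 0%N)%:R) * wdown (a 0%N) (b 0%N) *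
    (down_up_sum n (shift a) (shift b) -
     (a 1%N == a 0%N)%:R * x * wdown (a 1%N).+1 (b 1%N)
       * down_up_sum n.-1 (shift (shift a)) (shift (shift b)))
  = down_up_sum n.+1 a b
    - x * wdown (a 0%N).+1 (b 0%N) * down_up_sum n (shift a) (shift b).
Proof.
move=> na nb za zb; rewrite down_up_sumS.
have := na 0%N; have := nb 0%N; have := nb 1.
case: n za zb => [|n] za zb.
  have -> := za 1%N isT; have -> := zb 1%N isT; rewrite /down_up_sum /= !wdownS.
  move: (a 0%N) (b 0%N) => a0 b0 _ _ _.
  case: (posnP b0) => [->|b0_gt0].
    by case: (ltngtP 0 a0) => // [_|<-]; rewrite ?wdown_eq; rewrite /=; ring.
  rewrite wdown_pred // wdownS.
  case: (ltngtP b0 a0) => [ba|ab|ab].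
  - by case: (ltngtP 0 a0) => // h; [rewrite /=; ring|lia].
  - by rewrite wdown_lt //; case: eqP => _; rewrite /=; ring.
  - by rewrite -ab wdown_eq b0_gt0 (ltn_eqF b0_gt0); rewrite /=; ring.
rewrite down_up_sumS down_up2S /= {1 2 3 4 5 6 7 8 9 10 11 12 13 14}/shift.
(* The later columns now enter only through two indeterminates [s] and [d]; the one fact kept about
   them is that [d] vanishes if [b 2 = 0]. *)
have := @down_up2_eq0 n (shift (shift a)) (shift (shift b)).
move: (down_up_sum n _ _) (down_up n _ _).2 => s d.
rewrite {}/shift.
move: (a 0%N) (a 1%N) (b 0%N) (b 1%N) (b 2%N) => a0 a1 b0 b1 b2 d0 b21 b10 a10.
case: (posnP b0) => [b00|b0_gt0].
  have b1_0 : b1 = 0%N by lia.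
  have b2_0 : b2 = 0%N by lia.
  rewrite b00 b1_0 b2_0 /= (d0 b2_0) !wdownS.
  case: (ltngtP a1 a0) => [lt|gt|->]; [|lia|].
    by rewrite (leq_trans _ lt) //; rewrite /=; ring.
  by case: (ltngtP 0 a0) => // [_|<-]; rewrite ?wdown_eq; rewrite /=; ring.
rewrite (wdown_pred _ b0_gt0).
case: (ltngtP b1 b0) => [lt10|gt|e10]; [|lia|].
  case: (ltngtP a1 a0) => [lt|gt|->]; [rewrite /=; ring|lia|].
  case: (ltnP a0 b0) => [ab|ba]; first by rewrite (wdown_lt ab); rewrite /=; ring.
  have ba1 : (b1 < a0)%N by lia.
  rewrite (wdownS a0 b1) ba1.
  case: (posnP b1) => [b1_0|b1_gt0].
    have b2_0 : b2 = 0%N by lia.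
    by rewrite b1_0 b2_0 /= (d0 b2_0); rewrite /=; ring.
  by rewrite (wdown_pred _ b1_gt0) wdownS ba1; case: (b2 < b1)%N; rewrite /=; ring.
rewrite -{}e10 in b0_gt0 *; rewrite b0_gt0 (wdown_pred _ b0_gt0).
case: (ltngtP a1 a0) => [lt|gt|->]; [|lia|].
  case: (ltngtP b1 a0) => [ba|ab|ab].
  - by rewrite (wdownS a0) ba; rewrite /=; ring.
  - rewrite (wdown_lt ab) (wdownS a1) (wdown_lt (leq_trans lt (ltnW ab))).
    have -> : (b1 < a1)%N = false by lia.
    have -> : (a1 == b1) = false by lia.
    have -> : (a1.+1 == b1) = false by lia.
    by rewrite /=; ring.
  - by rewrite -ab in lt *; rewrite (wdown_lt lt) (wdownS b1) ltnn eqxx wdown_eq; rewrite /=; ring.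
rewrite !wdownS; case: (ltngtP b1 a0) => [ba|ab|->].
- by case: (b2 < b1)%N; rewrite /=; ring.
- by rewrite (wdown_lt ab); rewrite /=; ring.
- by rewrite wdown_eq; case: (b2 < a0)%N; rewrite /=; ring.
Qed.

(** Induction on the number of columns. If [a 0 = t], column 0 cannot grow, and the correction term
    on the right records the missing terms; with it the statement becomes inductive. For [n = 0] the
    convention [0.-1 = 0] makes the last sum equal to 1, which matches [overflow]. *)
Lemma up_down_overflow n a b t : noninc a -> noninc b ->
  (forall i, n <= i -> a i = 0)%N -> (forall i, n <= i -> b i = 0)%N ->
  (a 0%N <= t)%N ->
  (1 - x * y) * up_down n a b t + overflow n a b t =
  down_up_sum n a b - (a 0%N == t)%:R * x * wdown (a 0%N).+1 (b 0%N)
    * down_up_sum n.-1 (shift a) (shift b).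
Proof.
elim: n a b t => [|n IH] a b t na nb za zb a0t.
  rewrite /= /down_up_sum /= za // zb // wdownS /=.
  by case: (ltngtP 0 t) => //= _; ring.
have za' i : (n <= i)%N -> shift a i = 0%N by move=> ?; apply: za.
have zb' i : (n <= i)%N -> shift b i = 0%N by move=> ?; apply: zb.
have {}IH := IH _ _ _ (noninc_shift na) (noninc_shift nb) za' zb'.
have a10 := na 0.
have step := down_up_step na nb za zb.
rewrite [LHS](_ : _ = (1 - bt * x * (a 1%N < a 0%N)%:R) * wdown (a 0%N) (b 0%N) *
    ((1 - x * y) * up_down n (shift a) (shift b) (a 0%N)
     + overflow n (shift a) (shift b) (a 0%N))
  + (a 0%N < t)%:R * x * wdown (a 0%N).+1 (b 0%N) *
    ((1 - x * y) * up_down n (shift a) (shift b) (a 0%N).+1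
     + overflow n (shift a) (shift b) (a 0%N).+1)); last by rewrite /=; ring.
(* The induction hypothesis is used for both heights of the preceding column. For [(a 0).+1] its
   correction vanishes, because column 1 is then strictly lower. *)
rewrite (IH (a 0%N) a10) (IH (a 0%N).+1 (leqW a10)) step.
rewrite (_ : (shift a 0%N == (a 0%N).+1) = false); last by rewrite ltn_eqF // ltnS.
by case: (ltngtP (a 0%N) t) a0t => //= _ _; ring.
Qed.

(** An empty column can receive a box only if the preceding column has become nonempty, so filling
    the last one costs a factor [x] for every column. *)
Lemma overflow_empty n a b t : (forall i, a i = 0)%N ->
  exists q, overflow n a b t = (0 < t)%:R * x ^+ n * q.
Proof.
elim: n a b t => [|n IH] a b t a0 /=; first by exists (x * y); ring.
have a0' i : shift a i = 0%N by apply: a0.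
have [q1 ->] := IH (shift a) (shift b) (a 0%N) a0'.
have [q2 ->] := IH (shift a) (shift b) (a 0%N).+1 a0'.
by exists (wdown 1 (b 0%N) * q2); rewrite !a0 /= exprS; ring.
Qed.

Lemma overflow_dvd n k a b t : (forall i, k <= i -> a i = 0)%N ->
  exists q, overflow n a b t = x ^+ (n - k) * q.
Proof.
elim: k n a b t => [|k IH] n a b t ak.
  have [|q ->] := @overflow_empty n a b t; first by move=> i; apply: ak.
  by exists ((0 < t)%:R * q); rewrite subn0; ring.
case: n => [|n] /=; first by exists (x * y * (0 < t)%:R); rewrite expr0 mul1r.
have ak' i : (k <= i)%N -> shift a i = 0%N by move=> ?; apply: ak.
have [q1 ->] := IH n (shift a) (shift b) (a 0%N) ak'.
have [q2 ->] := IH n (shift a) (shift b) (a 0%N).+1 ak'.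
exists ((1 - bt * x * (a 1%N < a 0%N)%:R) * wdown (a 0%N) (b 0%N) * q1
   + (a 0%N < t)%:R * x * wdown (a 0%N).+1 (b 0%N) * q2).
by rewrite subSS; ring.
Qed.

(* The sum down_up taken column by column from the other end, s being the
   height of the column following the k given ones. *)
Fixpoint down_up_prefix (q : nat -> R) k (a b : nat -> nat) (s : nat) : R :=
  if k is k'.+1 then
    (1 - bt * x * (s < b k')%:R) * wdown (a k') (b k')
      * down_up_prefix q k' a b (b k')
    + (s < b k')%:R * x * wdown (a k') (b k').-1
      * down_up_prefix q k' a b (b k').-1
  else q s.

(** Column 0 is absorbed into the boundary function, which is why [q] is a parameter. *)
Lemma down_up_prefix_shift q k a b s :
  down_up_prefix q k.+1 a b s
  = down_up_prefix (down_up_prefix q 1 a b) k (shift a) (shift b) s.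
Proof.
elim: k s => [//|k IH] s.
by rewrite -[LHS]/(_ * down_up_prefix q k.+1 a b _ + _ * down_up_prefix q k.+1 a b _) !IH.
Qed.

(** Both recursions run over the same intermediate heights, from opposite ends. The argument of [q]
    is the intermediate height of column 0, which separates the two components of [down_up]. *)
Lemma down_up_prefixE q n a b : noninc b ->
  (forall i, n <= i -> b i = 0)%N ->
  down_up_prefix q n a b 0%N = (down_up n a b).1 * q (b 0%N)
    + (down_up n a b).2 * q (b 0%N).-1.
Proof.
elim: n q a b => [|n IH] q a b nb zb; first by rewrite /= zb //; ring.
rewrite down_up_prefix_shift IH; [|exact: noninc_shift|by move=> i ?; apply: zb].
have b10 : (b 1%N <= b 0%N)%N := nb 0.
have := @down_up2_eq0 n (shift a) (shift b).
rewrite /=; case: (down_up n _ _) => s d /=; rewrite /shift => d0.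
case: (posnP (b 1%N)) => [b1|b1].
  by rewrite b1 (d0 b1); case: (posnP (b 0%N)) => b0 /=; ring.
have -> : ((b 1%N).-1 < b 0%N)%N by lia.
have -> : (0 < b 0%N)%N by lia.
by case: (b 1%N < b 0%N)%N => /=; ring.
Qed.

Lemma eq_down_up_prefix q k a b b' s : (forall i, (i < k)%N -> b i = b' i) ->
  down_up_prefix q k a b s = down_up_prefix q k a b' s.
Proof.
elim: k s => //= k IH s e; rewrite (e k) // !IH // => i ik; apply: e; exact: ltnW.
Qed.

(** For [a 0 < t] the correction in [up_down_overflow] drops out, so the difference is exactly
    [overflow]. *)
Lemma up_down_down_up n k a b t : noninc a -> noninc b ->
  (forall i, k <= i -> a i = 0)%N -> (k <= n)%N -> (forall i, n <= i -> b i = 0)%N ->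
  (a 0%N < t)%N ->
  exists q, down_up_prefix (fun=> 1) n a b 0%N - (1 - x * y) * up_down n a b t
     = x ^+ (n - k) * q.
Proof.
move=> na nb ak kn bn a0t; have [q eq] := @overflow_dvd n k a b t ak.
exists q; rewrite -eq down_up_prefixE // !mulr1 -/(down_up_sum n a b).
have an i : (n <= i)%N -> a i = 0%N by move=> ?; apply: ak; lia.
have := up_down_overflow na nb an bn (ltnW a0t).
by rewrite (ltn_eqF a0t) /= !mul0r subr0 => <-; ring.
Qed.

End Transfer.

(** * Partitions through their column heights *)

(* Columns are numbered from 0 here. *)
Definition col (la : part) (k : nat) : nat := col_len la k.+1.

Lemma col_gt (la : part) i k : (i < col la k)%N = (k < nth 0%N la i)%N.
Proof. by rewrite /col /col_len -leq_nth_count //; case/andP: (valP la). Qed.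

Lemma col_inj (la mu : part) : col la =1 col mu -> la = mu.
Proof.
move=> e; apply: part_ext => i.
have h k : (k < nth 0%N la i)%N = (k < nth 0%N mu i)%N by rewrite -!col_gt e.
by have := h (nth 0%N la i); have := h (nth 0%N mu i); lia.
Qed.

Lemma col_noninc la : noninc (col la).
Proof.
move=> k; have h i : (i < col la k.+1)%N -> (i < col la k)%N.
  by rewrite !col_gt; apply: ltnW.
by have := h (col la k); lia.
Qed.

Definition width (la : part) : nat := nth 0%N la 0.

Lemma col_eq0 la k : (col la k == 0%N) = (width la <= k)%N.
Proof. by rewrite eqn0Ngt col_gt -leqNgt. Qed.

Lemma col_width0 la k : (width la <= k)%N -> col la k = 0%N.
Proof. by rewrite -col_eq0 => /eqP. Qed.

(** Conjugation: row [i] has as many cells as there are columns of height above [i]. All nonempty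
    columns lie in the window of length [K]. *)
Lemma part_of_col (f : nat -> nat) (K : nat) : noninc f -> f K = 0%N ->
  exists la, col la =1 f.
Proof.
move=> nf fK.
pose r i := count (fun k => i < f k)%N (iota 0 K).
(* The two counting bounds, below and above, let the start [m] of the window vary so that induction
   on its length applies. *)
have cnt i k m : (forall j, (m <= j)%N -> (j <= k)%N -> (i < f j)%N) ->
    (m <= k)%N -> (k < m + K)%N -> (k - m < count (fun j => i < f j)%N (iota m K))%N.
  elim: K {fK r} m => [|K' IH] m all mk km; first by lia.
  rewrite /= all //; case: (ltngtP m k) mk => // [lt|->] _; last by lia.
  have := IH m.+1 (fun j mj => all j (ltnW mj)) lt; lia.
have cnt0 i k m : (forall j, (k <= j)%N -> (f j <= i)%N) ->
    (count (fun j => i < f j)%N (iota m K) <= k - m)%N.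
  elim: K {fK r cnt} m => [//|K' IH] m all /=.
  have {}IH := IH m.+1 all; case: (leqP k m) => [/all|]; lia.
have rP i k : (k < r i)%N = (i < f k)%N.
  case: (ltnP i (f k)) => [lt|ge].
    have kK : (k < K)%N.
      by rewrite ltnNge; apply/negP => Kk; have := noninc_le nf Kk; lia.
    have := cnt i k 0%N; rewrite subn0; apply => // j _ jk.
    by have := noninc_le nf jk; lia.
  apply/negbTE; rewrite -leqNgt.
  have := cnt0 i k 0%N; rewrite subn0; apply => j kj.
  by have := noninc_le nf kj; lia.
pose s := mkseq r (f 0%N).
have ns i : nth 0%N s i = r i.
  case: (ltnP i (f 0%N)) => h; first by rewrite nth_mkseq.
  rewrite nth_default ?size_mkseq //; apply/esym/eqP; by rewrite -leqn0 leqNgt rP -leqNgt.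
have /is_part_nth [ip en] : forall k, (nth 0 s k.+1 <= nth 0 s k)%N.
  move=> i; rewrite !ns leqNgt rP -leqNgt; have := rP i (r i); lia.
exists (Part ip) => k.
have h i : (i < col (Part ip) k)%N = (i < f k)%N by rewrite col_gt /= en ns rP.
by have := h (col (Part ip) k); have := h (f k); lia.
Qed.

Lemma box_added_col (k : nat) (la mu : part) : (exists i, box_added i k.+1 la mu) <->
  forall j, col mu j = (col la j + (j == k))%N.
Proof.
split=> [[i /box_addedP[i0 lk _ e]] j|e].
  have h r : (r < col mu j)%N = (r < col la j)%N || ((r == i.-1) && (j == k)).
    rewrite !col_gt e eq_sym; case: (r =P i.-1) => [->|ne]; rewrite ?lk /=; lia.
  have := h (col mu j); have := h (col la j).
  have := col_gt la i.-1 j; rewrite lk.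
  have := h i.-1; have := h (col la j).+1; rewrite eqxx.
  case: (j =P k) => [->|_]; rewrite ?andbF ?andbT ?orbF; lia.
exists (col la k).+1; apply/box_addedP; rewrite /=.
have nk : nth 0%N la (col la k) = k.
  have := col_gt la (col la k) k; rewrite ltnn => /esym/negbT; rewrite -leqNgt => h.
  apply/eqP; rewrite eqn_leq h /=; case: k e h => // k e h.
  rewrite -col_gt; have := col_noninc mu k; rewrite !e eqxx; lia.
split=> // r.
have h j : (j < nth 0%N mu r)%N = (j < nth 0%N la r)%N || ((r == col la k) && (j == k)).
  by rewrite -!col_gt e; case: (j =P k) => [->|]; rewrite ?andbF ?andbT ?orbF; lia.
case: eqP => [er|ne].
  move: h; rewrite -er nk eqxx /= => h.
  have := h k; have := h k.+1; have := h (nth 0%N mu (col la k)).-1; lia.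
have := h (nth 0%N mu r); have := h (nth 0%N la r); lia.
Qed.

Lemma add_box_col k la mu : add_box k.+1 la = Some mu <->
  forall j, col mu j = (col la j + (j == k))%N.
Proof. by rewrite add_boxP box_added_col. Qed.

Lemma rem_box_col k la mu : rem_box k.+1 la = Some mu <->
  forall j, col la j = (col mu j + (j == k))%N.
Proof. by rewrite rem_boxP box_added_col. Qed.

Lemma rem_add_box k la mu : rem_box k.+1 la = Some mu <-> add_box k.+1 mu = Some la.
Proof. by rewrite rem_box_col add_box_col. Qed.

Lemma add_box_None k la : add_box k.+1 la = None <->
  (0 < k)%N /\ col la k.-1 = col la k.
Proof.
split=> [none|[k0 e]].
  case: (boolP ((0 < k)%N && (col la k.-1 == col la k))) => [/andP[? /eqP]//|h].
  have nf : noninc (fun j => col la j + (j == k))%N.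
    move=> j; have := col_noninc la j.
    case: (j.+1 =P k) => [ej|_]; last by lia.
    by move: h; rewrite -ej /=; lia.
  (* The index [width la + k.+1] lies beyond both [la] and column [k], so the raised heights vanish
     there. *)
  have [|mu /add_box_col] := @part_of_col _ (width la + k.+1) nf; last by rewrite none.
  by rewrite col_width0 ?leq_addr // (gtn_eqF (ltn_addl _ (ltnSn k))).
case E: (add_box _ _) => [mu|//]; have /add_box_col {}E := E.
have := col_noninc mu k.-1; rewrite prednK // !E eqxx e; lia.
Qed.

Lemma rem_box_None k la : rem_box k.+1 la = None <-> col la k = col la k.+1.
Proof.
split=> [none|e].
  have := col_noninc la k; rewrite leq_eqVlt => /orP[/eqP//|lt].
  have nf : noninc (fun j => col la j - (j == k))%N.
    by move=> j; have := col_noninc la j; case: (j =P k) => [->|_]; lia.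
  have [|mu E] := @part_of_col _ (width la) nf; first by rewrite col_width0.
  suff /rem_box_col : forall j, col la j = (col mu j + (j == k))%N by rewrite none.
  by move=> j; rewrite E; case: (j =P k) => [->|_]; lia.
case E: (rem_box _ _) => [mu|//]; have /rem_box_col {}E := E.
have := col_noninc mu k; move: e; rewrite !E eqxx; lia.
Qed.

Lemma width_add_box k la mu : add_box k.+1 la = Some mu ->
  (width la <= width mu <= (width la).+1)%N.
Proof.
move/add_box_col => e.
have h j : (width mu <= j)%N = (width la <= j)%N && (j != k).
  by rewrite -!col_eq0 e; case: (j =P k) => _; rewrite ?andbT ?andbF; lia.
have := h (width mu); have := h (width la); have := h (width la).+1; lia.
Qed.

(** * Matrix coefficients of the truncated products *)

Lemma linextEw (f : part -> Pmod) (v : Pmod) (d : {fset part}) :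
  (msupp v `<=` d)%fset -> linext f v = \sum_(la <- d) v@_la *: f la.
Proof.
move=> le; rewrite /linext; apply: (big_fset_incl _ le) => la _ /mcoeff_outdom ->.
by rewrite scale0r.
Qed.

Lemma linext_linear f : linear (linext f).
Proof.
move=> c v w; pose d := (msupp v `|` msupp w)%fset.
rewrite (@linextEw f v d) ?fsubsetUl // (@linextEw f w d) ?fsubsetUr //.
rewrite (@linextEw f _ d); last first.
  apply: fsubset_trans (msuppD_le _ _) _; apply: fsetSU; exact: msuppZ_le.
rewrite scaler_sumr -big_split; apply: eq_bigr => la _.
by rewrite mcoeffD mcoeffZ scalerDl scalerA.
Qed.

Lemma linext_basis f la : linext f (basis la) = f la.
Proof.
rewrite (@linextEw f _ [fset la]%fset) ?msuppU_le // big_seq_fset1.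
by rewrite mcoeffUU scale1r.
Qed.

Lemma basis_coef la nu : (basis la)@_nu = (la == nu)%:R.
Proof. exact: mcoeffU. Qed.

Lemma linear_sum_basis (T : Pmod -> Pmod) (v : Pmod) : linear T ->
  T v = \sum_(la <- msupp v) v@_la *: T (basis la).
Proof.
(* The operators are bare functions with a proof of linearity; bundling [T] gives access to
   [linear_sum]. *)
move=> lT; pose LT := GRing.isLinear.Build _ _ _ _ T lT.
pose T' : {linear Pmod -> Pmod} := HB.pack T LT.
rewrite [in LHS](monalgE v) -[T]/(T' : _ -> _) linear_sum; apply: eq_bigr => la _.
rewrite -linearZ; congr (T' _); apply/malgP => nu.
by rewrite mcoeffZ !mcoeffU; case: (la == nu); rewrite ?mulr0 ?mulr1.
Qed.

Lemma linear_coef (T : Pmod -> Pmod) (v : Pmod) nu : linear T ->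
  (T v)@_nu = \sum_(la <- msupp v) v@_la * (T (basis la))@_nu.
Proof.
move=> lT; rewrite (linear_sum_basis v lT) raddf_sum; apply: eq_bigr => la _.
exact: mcoeffZ.
Qed.

Section LinearOperator.
Context (R : comNzRingType) (K : choiceType).
Context (T : {malg R[K]} -> {malg R[K]}) (lT : linear T).

Lemma linear_op0 : T 0 = 0.
Proof. by have := lT (-1) 0 0; rewrite scaler0 addr0 scaleN1r addNr. Qed.

Lemma linear_opZ c v : T (c *: v) = c *: T v.
Proof. by rewrite -[c *: v in LHS]addr0 lT [T 0]linear_op0 addr0. Qed.

Lemma linear_opB v w : T (v - w) = T v - T w.
Proof. by have := lT (-1) w v; rewrite !scaleN1r ![- _ + _]addrC. Qed.

Lemma linear_op_coef2 a b v w nu :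
  (T (a *: v + b *: w))@_nu = a * (T v)@_nu + b * (T w)@_nu.
Proof.
rewrite (lT a v (b *: w)) (linear_opZ b w).
by rewrite (mcoeffD nu (a *: T v)) (mcoeffZ a (T v)) (mcoeffZ b (T w)).
Qed.

End LinearOperator.

Lemma sum_msupp_single (v : Pmod) (F : part -> pol) la0 :
  (forall la, la != la0 -> v@_la * F la = 0) ->
  \sum_(la <- msupp v) v@_la * F la = v@_la0 * F la0.
Proof.
move=> h; case: (boolP (la0 \in msupp v)) => [in0|/mcoeff_outdom e].
  by rewrite (bigD1_seq la0) ?fset_uniq //= big1 ?addr0 // => la /h.
rewrite e mul0r big1 // => la _; case: (eqVneq la la0) => [->|/h //].
by rewrite e mul0r.
Qed.

(** As [g] is a partial injection with inverse [h], only the basis element [h nu] can contribute at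
    [nu]. This yields the coefficients of [u_op] and [d_op] from the target side. *)
Lemma linext_pinv_coef (g h : part -> option part) (v : Pmod) nu :
  (forall la mu, g la = Some mu <-> h mu = Some la) ->
  (linext (fun la => oapp basis 0 (g la)) v)@_nu = oapp (fun la => v@_la) 0 (h nu).
Proof.
move=> gh; rewrite raddf_sum /=.
under eq_bigr => la _ do rewrite mcoeffZ.
have gP la : (oapp basis 0 (g la))@_nu = (h nu == Some la)%:R.
  case E: (g la) => [mu|] /=; last first.
    by rewrite mcoeff0; case: eqP => // /gh; rewrite E.
  rewrite basis_coef; congr (nat_of_bool _)%:R; apply/eqP/eqP => [<-|/gh].
    exact/gh.
  by rewrite E => -[].
under eq_bigr => la _ do rewrite gP.
case: (h nu) => [la0|] /=; last by rewrite big1 // => la _; rewrite mulr0.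
rewrite (@sum_msupp_single v (fun la => (Some la0 == Some la)%:R) la0) ?eqxx ?mulr1 //.
move=> la ne; case: eqP => [[e]|_]; rewrite ?mulr0 //.
by rewrite e eqxx in ne.
Qed.

Lemma u_op_coef k w nu :
  (u_op k.+1 w)@_nu = oapp (fun la => w@_la) 0 (rem_box k.+1 nu).
Proof. by apply: linext_pinv_coef => la mu; rewrite rem_add_box. Qed.

Lemma d_op_coef k w nu :
  (d_op k.+1 w)@_nu = oapp (fun la => w@_la) 0 (add_box k.+1 nu).
Proof. by apply: linext_pinv_coef => la mu; rewrite rem_add_box. Qed.

Lemma u_op_linear i : linear (u_op i). Proof. exact: linext_linear. Qed.
Lemma d_op_linear i : linear (d_op i). Proof. exact: linext_linear. Qed.
Lemma dt_op_linear i : linear (dt_op i). Proof. exact: linext_linear. Qed.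

Lemma ut_op_linear i : linear (ut_op i).
Proof.
move=> c v w; rewrite /ut_op.
rewrite -[RHS](u_op_linear i c (v - beta *: d_op i v) (w - beta *: d_op i w)).
congr (u_op i _); rewrite (d_op_linear i c v w).
move: (d_op i v) (d_op i w) => dv dw.
by rewrite scalerDr scalerBr !scalerA [beta * c]mulrC opprD addrACA.
Qed.

Definition A_factor (x : pol) i (w : Pmod) := w + x *: ut_op i w.
Definition B_factor (y : pol) i (w : Pmod) := w + y *: dt_op i w.

Lemma add_scale_linear (R : comNzRingType) (V : lmodType R) (T : V -> V) (c : R) :
  linear T -> linear (fun w => w + c *: T w).
Proof.
move=> lT a v w; rewrite lT !scalerDr !scalerA [c * a]mulrC !addrA; congr (_ + _).
by rewrite addrAC.
Qed.

Lemma A_factor_linear x i : linear (A_factor x i).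
Proof. exact: add_scale_linear (ut_op_linear i). Qed.

Lemma B_factor_linear y i : linear (B_factor y i).
Proof. exact: add_scale_linear (dt_op_linear i). Qed.

Lemma foldl_linear I (f : I -> Pmod -> Pmod) s : (forall i, linear (f i)) ->
  linear (fun v => foldl (fun w i => f i w) v s).
Proof. by move=> lf; elim: s => //= i s IH c v w; rewrite lf IH. Qed.

Lemma foldr_linear I (f : I -> Pmod -> Pmod) s : (forall i, linear (f i)) ->
  linear (fun v => foldr f v s).
Proof. by move=> lf; elim: s => //= i s IH c v w; rewrite IH lf. Qed.

Lemma A_trunc_linear N x : linear (A_trunc N x).
Proof. exact: (foldl_linear _ (A_factor_linear x)). Qed.

Lemma B_trunc_linear N y : linear (B_trunc N y).
Proof. exact: (foldr_linear _ (B_factor_linear y)). Qed.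

Lemma A_truncS N x v : A_trunc N.+1 x v = A_factor x N.+1 (A_trunc N x v).
Proof. by rewrite /A_trunc -{1}(addn1 N) iotaD foldl_cat /= add1n. Qed.

Lemma B_truncS N y v : B_trunc N.+1 y v = B_trunc N y (B_factor y N.+1 v).
Proof. by rewrite /B_trunc -{1}(addn1 N) iotaD foldr_cat /= add1n. Qed.

(** Applying [d_op] and reading at [ka] returns the coefficient at [nu], since putting the box back
    on [ka] gives [nu]. *)
Lemma A_factor_coef x k w nu : (A_factor x k.+1 w)@_nu =
  w@_nu + x * oapp (fun ka => w@_ka - beta * w@_nu) 0 (rem_box k.+1 nu).
Proof.
rewrite mcoeffD mcoeffZ u_op_coef; congr (_ + x * _).
case E: (rem_box _ _) => [ka|] //=.
by rewrite mcoeffB mcoeffZ d_op_coef ((proj1 (rem_add_box _ _ _)) E).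
Qed.

Lemma scale_factor (R : comNzRingType) (V : lmodType R) (b x c : R) (v w : V) :
  v + x *: (w - b *: (c *: v)) = (1 - b * x * c) *: v + x *: w.
Proof.
rewrite scalerBr scalerBl scale1r !scalerA (mulrA x b c) (mulrC x b).
by rewrite addrA addrAC.
Qed.

(** The composite of [d_op] and [u_op] in one column is the projection onto the partitions from
    which a box of that column can be removed. *)
Lemma A_factor_basis x k la : A_factor x k.+1 (basis la) =
  (1 - beta * x * (col la k.+1 < col la k)%:R) *: basis la
    + x *: oapp basis 0 (add_box k.+1 la).
Proof.
rewrite /A_factor /ut_op (linear_opB (u_op_linear _)) (linear_opZ (u_op_linear _)).
rewrite /u_op /d_op !linext_basis.
have -> : linext (fun la => oapp basis 0 (add_box k.+1 la)) (oapp basis 0 (rem_box k.+1 la))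
    = (col la k.+1 < col la k)%:R *: basis la.
  case E: (rem_box _ _) => [mu|] /=.
    rewrite linext_basis ((proj1 (rem_add_box _ _ _)) E) /=.
    have /rem_box_col {}E := E.
    have := col_noninc mu k; have := E k; have := E k.+1.
    rewrite eqxx (gtn_eqF (ltnSn k)) => -> -> h.
    by rewrite (_ : (_ < _)%N) ?scale1r //; lia.
  move/rem_box_None: E => ->; rewrite ltnn scale0r.
  exact: linear_op0 (linext_linear _).
exact: scale_factor.
Qed.

Lemma iter_d_op_coef k la j nu : (iter j (d_op k.+1) (basis la))@_nu =
  (`[< forall i, col la i = col nu i + j * (i == k) >]%N)%:R.
Proof.
elim: j nu => [|j IH] nu.
  rewrite basis_coef; congr (nat_of_bool _)%:R; apply/eqP/asboolP => [-> i|e].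
    by rewrite mul0n addn0.
  by apply: col_inj => i; rewrite e mul0n addn0.
rewrite iterS d_op_coef; case E: (add_box _ _) => [mu|] /=.
  have /add_box_col {}E := E; rewrite IH; congr (nat_of_bool _)%:R.
  by apply: asbool_equiv_eq; split=> e i; rewrite e E; lia.
(* If no box fits on [nu] in column [k], then columns [k.-1] and [k] of [nu] are equal, and no
   partition exceeds [nu] in column [k] alone. *)
case: asboolP => // e; have /add_box_None [k0 ek] := E.
have := col_noninc la k.-1; rewrite prednK // !e eqxx -ek.
have -> : (k.-1 == k) = false by lia.
by lia.
Qed.

Section Columns.
Context (x y : pol).
Local Notation wd := (wdown beta y).

(** In the series for [dt_op] only the power equal to the height difference in column [k] reaches
    [nu]. *)
Lemma B_factor_coef k la nu : (forall i, i != k -> col la i = col nu i) ->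
  (B_factor y k.+1 (basis la))@_nu = wd (col la k) (col nu k).
Proof.
move=> off; rewrite mcoeffD mcoeffZ /dt_op linext_basis basis_coef raddf_sum /=.
under eq_bigr => j _ do rewrite mcoeffZ iter_d_op_coef.
have asE j : `[< forall i, col la i = col nu i + j * (i == k) >]%N
    = (col la k == col nu k + j)%N.
  apply/asboolP/eqP => [/(_ k)|e i]; first by rewrite eqxx muln1.
  by case: (i =P k) => [->|/eqP ne]; rewrite ?muln1 // muln0 addn0 off.
under eq_bigr => j _ do rewrite asE.
have -> : (la == nu) = (col la k == col nu k).
  apply/eqP/eqP => [->//|e]; apply: col_inj => i.
  by case: (i =P k) => [->//|/eqP /off].
rewrite -/(col la k) /wdown; case: (ltngtP (col la k) (col nu k)) => [lt|lt|e].
- rewrite big_nat big1 ?mulr0 ?addr0 // => j _.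
  by rewrite (_ : (_ == _) = false) ?mulr0 //; lia.
- rewrite (bigD1_seq (col la k - col nu k)%N) ?iota_uniq //=; last first.
    by rewrite mem_index_iota; lia.
  rewrite big1_seq ?addr0 ?add0r => [|j /andP[ne _]].
    by rewrite subnKC ?eqxx ?mulr1 // ltnW.
  by rewrite (_ : (_ == _) = false) ?mulr0 //; lia.
- rewrite big_nat big1 ?mulr0 ?addr0 // => j /andP[j1 _].
  by rewrite (_ : (_ == _) = false) ?mulr0 //; lia.
Qed.

Lemma B_factor_coef_off k la nu i : i != k -> col la i != col nu i ->
  (B_factor y k.+1 (basis la))@_nu = 0.
Proof.
move=> ik ne; rewrite mcoeffD mcoeffZ /dt_op linext_basis basis_coef raddf_sum /=.
rewrite (_ : (la == nu) = false); last by apply: contraNF ne => /eqP ->.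
rewrite big1 ?mulr0 ?addr0 // => j _; rewrite mcoeffZ iter_d_op_coef.
case: asboolP => [/(_ i)|_]; rewrite ?mulr0 //.
by rewrite (negbTE ik) muln0 addn0 => e; rewrite e eqxx in ne.
Qed.

Lemma B_trunc_coef_off N la nu i : (N <= i)%N -> col la i != col nu i ->
  (B_trunc N y (basis la))@_nu = 0.
Proof.
elim: N la => [|N IH] la Ni ne.
  by rewrite basis_coef; case: (la =P nu) => // e; rewrite e eqxx in ne.
rewrite B_truncS (linear_coef _ _ (@B_trunc_linear N y)).
rewrite big1 // => ka _; case: (eqVneq (col la i) (col ka i)) => e.
  by rewrite IH ?mulr0 ?(ltnW Ni) // -e.
by rewrite (B_factor_coef_off _ e) ?mul0r //; lia.
Qed.

(** The columns are lowered from right to left, so no column is obstructed by its right neighbour,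
    and there is a single intermediate partition after each factor. *)
Lemma B_trunc_coef N la nu : (forall i, N <= i -> col la i = col nu i)%N ->
  (B_trunc N y (basis la))@_nu = \prod_(i < N) wd (col la i) (col nu i).
Proof.
elim: N la => [|N IH] la ag.
  by rewrite big_ord0 basis_coef (_ : la = nu) ?eqxx //; apply: col_inj => i; apply: ag.
rewrite big_ord_recr /= B_truncS (linear_coef _ _ (@B_trunc_linear N y)).
case: (ltnP (col la N) (col nu N)) => [lt|ge].
  rewrite wdown_lt // mulr0 big1 // => ka _.
  case: (eqVneq (col ka N) (col nu N)) => [e|ne]; last first.
    by rewrite (B_trunc_coef_off (leqnn N) ne) mulr0.
  case: (pselect (forall i, i != N -> col la i = col ka i)) => [off|].
    by rewrite B_factor_coef // wdown_lt ?mul0r // e.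
  case/asboolPn/existsp_asboolPn => i /asboolPn/imply_asboolPn [iN /eqP ne].
  by rewrite (B_factor_coef_off iN ne) mul0r.
(* These are the heights after the first factor has acted: column [N] is final and the others are
   untouched. They do not increase, because column [N.+1] of [la] is already that of [nu]. *)
pose f i := if i == N then col nu N else col la i.
have nf : noninc f.
  move=> i; have := col_noninc la i; rewrite /f.
  case: (i =P N) => [->|_]; last by case: (i.+1 =P N) => [->|_]; lia.
  by rewrite (gtn_eqF (ltnSn N)) ag // col_noninc.
have [|ka0 ek] := @part_of_col f (width la + N.+1) nf.
  rewrite /f (gtn_eqF (ltn_addl _ (ltnSn N))) col_width0 ?leq_addr //.
rewrite (@sum_msupp_single _ (fun ka => (B_trunc N y (basis ka))@_nu) ka0).
  rewrite B_factor_coef => [|i iN]; last by rewrite ek /f (negbTE iN).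
  rewrite IH => [|i Ni]; last first.
    rewrite ek /f; case: (i =P N) => [->//|/eqP iN]; apply: ag; lia.
  have -> : col ka0 N = col nu N by rewrite ek /f eqxx.
  rewrite [LHS]mulrC; apply: (congr1 (fun z => z * _)); apply: eq_bigr => i _.
  by rewrite ek /f (ltn_eqF (ltn_ord i)).
move=> ka ne.
case: (pselect (forall i, i != N -> col la i = col ka i)) => [off|]; last first.
  case/asboolPn/existsp_asboolPn => i /asboolPn/imply_asboolPn [iN /eqP ne'].
  by rewrite (B_factor_coef_off iN ne') mul0r.
case: (eqVneq (col ka N) (col nu N)) => [e|ne']; last first.
  by rewrite (B_trunc_coef_off (leqnn N) ne') mulr0.
case/eqP: ne; apply: col_inj => i; rewrite ek /f; case: (i =P N) => [->//|/eqP /off //].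
Qed.
End Columns.

(** * Commutation of the truncated products on basis elements *)

Section Commutation.
Context (x y : pol) (N : nat).
Local Notation wd := (wdown beta y).

(** The first [k] columns have passed their factors of [A] and contribute only their weights under
    [B]. The induction varies [la], since each factor may add a box to it. For [k = 0] the value
    [(col la 0).+1] of [t] expresses that column 0 can always grow. *)
Lemma foldl_A_factor_coef k m (la nu : part) t : (k + m = N)%N ->
  (forall i, N <= i -> col la i = col nu i)%N ->
  t = (if k is k'.+1 then col la k' else (col la 0).+1) ->
  (B_trunc N y (foldl (fun w i => A_factor x i w) (basis la) (iota k.+1 m)))@_nu =
  (\prod_(i < k) wd (col la i) (col nu i)) *
  up_down beta x y m (fun i => col la (k + i)%N) (fun i => col nu (k + i)%N) t.
Proof.
elim: m k la t => [|m IH] k la t kmN ag tP.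
  by rewrite /= mulr1 B_trunc_coef // -kmN addn0.
pose T w := B_trunc N y (foldl (fun w i => A_factor x i w) w (iota k.+2 m)).
have lT : linear T.
  move=> c v w; rewrite /T (foldl_linear _ (A_factor_linear x)).
  exact: B_trunc_linear.
rewrite -[LHS]/((T (A_factor x k.+1 (basis la)))@_nu) A_factor_basis.
rewrite [LHS](linear_op_coef2 lT).
have kmN' : (k.+1 + m = N)%N by lia.
rewrite {1}/T (IH _ _ (col la k) kmN' ag erefl) big_ord_recr /=.
have sh (f : nat -> nat) : shift (fun i => f (k + i)%N) = (fun i => f (k.+1 + i)%N).
  by apply: funext => i; rewrite /shift addnS.
rewrite !sh !addn0 addn1.
(* A box fits in column [k] exactly when that column is lower than the preceding one, of height
   [t]. *)
have -> : (T (oapp basis 0 (add_box k.+1 la)))@_nu =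
   if (col la k < t)%N then
   (\prod_(i < k) wd (col la i) (col nu i)) * wd (col la k).+1 (col nu k) *
   up_down beta x y m (fun i => col la (k.+1 + i)%N) (fun i => col nu (k.+1 + i)%N) (col la k).+1
   else 0.
  case E: (add_box _ _) => [mu|] /=.
    have Ec := (proj1 (add_box_col _ _ _) E).
    have -> : (col la k < t)%N.
      case: k {sh kmN kmN' T lT} tP E Ec => [-> //|k -> E Ec].
      by have := col_noninc mu k; rewrite !Ec eqxx; lia.
    have ag' i : (N <= i)%N -> col mu i = col nu i.
      by move=> Ni; rewrite Ec -ag // (_ : (i == k) = false) ?addn0 //; lia.
    have ek : (col la k).+1 = col mu k by rewrite Ec eqxx addn1.
    rewrite /T (IH _ _ (col la k).+1 kmN' ag' ek).
    have -> : (fun i => col mu (k.+1 + i)%N) = (fun i => col la (k.+1 + i)%N).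
      by apply: funext => i; rewrite Ec (_ : (_ == k) = false) ?addn0 //; lia.
    rewrite big_ord_recr /= -ek.
    have e1 : \prod_(i < k) wd (col mu i) (col nu i) = \prod_(i < k) wd (col la i) (col nu i).
      by apply: eq_bigr => i _; rewrite Ec (ltn_eqF (ltn_ord i)) addn0.
    exact: (congr1 (fun p => p * _ * _) e1).
  have /add_box_None [k0 e] := E.
  rewrite (linear_op0 lT) mcoeff0 (_ : (col la k < t)%N = false) //.
  by case: k {sh kmN kmN' T lT E} tP k0 e => // k -> _ /= ->; rewrite ltnn.
move: (\prod_(i < k) _) (up_down _ _ _ _ _ _ _) (up_down _ _ _ _ _ _ _) (wd _ _) (wd _ _).
by case: (col la k < t)%N => p u1 u2 w1 w2 /=; ring.
Qed.

Lemma B_A_trunc_coef la nu : (forall i, N <= i -> col la i = col nu i)%N ->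
  (B_trunc N y (A_trunc N x (basis la)))@_nu =
  up_down beta x y N (col la) (col nu) (col la 0).+1.
Proof.
move=> ag; rewrite /A_trunc (@foldl_A_factor_coef 0 N la nu (col la 0).+1) //.
by rewrite big_ord0 mul1r.
Qed.

(** Here the factors of [A] are undone from the last one, starting at [nu]. Columns from [k] on are
    not yet changed by [A], which leaves their weights under [B]. *)
Lemma A_B_trunc_prefix_coef k la nu : (k <= N)%N ->
  (forall i, N <= i -> col la i = col nu i)%N ->
  (A_trunc k x (B_trunc N y (basis la)))@_nu =
  down_up_prefix beta x y (fun=> 1) k (col la) (col nu) (col nu k) *
  \prod_(k <= i < N) wd (col la i) (col nu i).
Proof.
elim: k nu => [|k IH] nu kN ag.
  by rewrite /= mul1r big_mkord -B_trunc_coef.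
have [P PE] : exists P, P = \prod_(k.+1 <= i < N) wd (col la i) (col nu i) by eexists.
rewrite A_truncS A_factor_coef IH 1?ltnW //= (@big_ltn _ _ _ k) // -PE.
(* The partition before the factor is [nu], or [nu] without a box in column [k]; the latter exists
   only if column [k] is higher than the next. The weights [P] of the later columns are common to
   both. *)
have -> : oapp (fun ka => (A_trunc k x (B_trunc N y (basis la)))@_ka - beta *
    (down_up_prefix beta x y (fun=> 1) k (col la) (col nu) (col nu k) *
     (wd (col la k) (col nu k) * P))) 0
    (rem_box k.+1 nu) =
  (col nu k.+1 < col nu k)%:R *
   (down_up_prefix beta x y (fun=> 1) k (col la) (col nu) (col nu k).-1 *
     wd (col la k) (col nu k).-1 - beta *
    down_up_prefix beta x y (fun=> 1) k (col la) (col nu) (col nu k) *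
     wd (col la k) (col nu k)) * P.
  case E: (rem_box _ _) => [ka|] /=; last first.
    by move/rem_box_None: E => ->; rewrite ltnn !mul0r.
  have /rem_box_col Ec := E.
  have ek : col nu k = (col ka k).+1 by rewrite Ec eqxx addn1.
  have -> : (col nu k.+1 < col nu k)%N.
    by rewrite ek ltnS Ec (gtn_eqF (ltnSn k)) addn0 col_noninc.
  have ene i : i != k -> col nu i = col ka i by move=> /negbTE ne; rewrite Ec ne addn0.
  rewrite IH ?(ltnW kN) //; last by move=> i Ni; rewrite ag // ene //; lia.
  rewrite (@big_ltn _ _ _ k) // ek /=.
  rewrite (@eq_down_up_prefix _ _ _ _ _ k _ (col nu) (col ka) (col ka k)); last first.
    by move=> i ik; apply: ene; lia.
  have -> : \prod_(k.+1 <= i < N) wd (col la i) (col ka i) = P.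
    by rewrite PE; apply: eq_big_nat => i ik; rewrite ene //; lia.
  move: (down_up_prefix _ _ _ _ _ _ _ _) (down_up_prefix _ _ _ _ _ _ _ _) (wd _ _) (wd _ _).
  by move=> d1 d2 w1 w2; ring.
move: (down_up_prefix _ _ _ _ _ _ _ _) (down_up_prefix _ _ _ _ _ _ _ _) (wd _ _) (wd _ _).
by move=> d1 d2 w1 w2; ring.
Qed.

Lemma A_B_trunc_commute la nu : (width la <= N)%N -> (width nu <= N)%N ->
  exists q, (A_trunc N x (B_trunc N y (basis la)))@_nu
    - (1 - x * y) * (B_trunc N y (A_trunc N x (basis la)))@_nu
    = x ^+ (N - width la) * q.
Proof.
move=> laN nuN.
have nuz i : (N <= i)%N -> col nu i = 0%N by move=> Ni; apply: col_width0; lia.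
have ag i : (N <= i)%N -> col la i = col nu i.
  by move=> Ni; rewrite nuz // col_width0 //; lia.
rewrite A_B_trunc_prefix_coef // big_geq // mulr1 nuz // B_A_trunc_coef //.
apply: up_down_down_up => //; try exact: col_noninc.
by move=> i; apply: col_width0.
Qed.
End Commutation.

(** * Commutation up to terms of high order *)

Section Order.
Context (R : comNzRingType) (I : choiceType).
Implicit Types P Q : {malg R[{cmonom I}]}.

Definition order_ge k P := forall p : {cmonom I}, (mdeg p < k)%N -> P@_p = 0.

Lemma order_ge0 k : order_ge k 0.
Proof. by move=> p _; rewrite mcoeff0. Qed.

Lemma order_geD k P Q : order_ge k P -> order_ge k Q -> order_ge k (P + Q).
Proof. by move=> hP hQ p pk; rewrite mcoeffD hP // hQ // addr0. Qed.

Lemma order_geN k P : order_ge k P -> order_ge k (- P).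
Proof. by move=> hP p pk; rewrite mcoeffN hP // oppr0. Qed.

Lemma order_geB k P Q : order_ge k P -> order_ge k Q -> order_ge k (P - Q).
Proof. by move=> hP hQ; apply: order_geD => //; apply: order_geN. Qed.

Lemma order_ge_le k l P : (l <= k)%N -> order_ge k P -> order_ge l P.
Proof. by move=> lk hP p pl; apply: hP; apply: leq_trans lk. Qed.

Lemma order_ge_trivial P : order_ge 0 P.
Proof. by move=> p. Qed.

Lemma order_geM k l P Q : order_ge k P -> order_ge l Q -> order_ge (k + l) (P * Q).
Proof.
move=> hP hQ p pk; apply/eqP; rewrite mcoeff_eq0; apply/negP => /msuppM_le [p1 [p2 []]].
rewrite -!mcoeff_neq0 => /eqP h1 /eqP h2 e; rewrite e mdegM in pk.
case: (ltnP (mdeg p1) k) => [/hP //|k1]; case: (ltnP (mdeg p2) l) => [/hQ //|l2].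
lia.
Qed.

Lemma order_geMl k P Q : order_ge k Q -> order_ge k (P * Q).
Proof. by move=> hQ; rewrite -[k]add0n; apply: order_geM => //; apply: order_ge_trivial. Qed.

Lemma order_geMr k P Q : order_ge k P -> order_ge k (P * Q).
Proof. by move=> hP; rewrite mulrC; apply: order_geMl. Qed.

Lemma order_geX n P : order_ge 1 P -> order_ge n (P ^+ n).
Proof.
move=> hP; elim: n => [|n IH]; first exact: order_ge_trivial.
by rewrite exprS -add1n; apply: order_geM.
Qed.

Lemma order_ge_sum (T : Type) (s : seq T) k (F : T -> {malg R[{cmonom I}]}) :
  (forall t, order_ge k (F t)) -> order_ge k (\sum_(t <- s) F t).
Proof.
by move=> h; elim/big_rec: _ => [|t P _]; [exact: order_ge0 | apply: order_geD].
Qed.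

Lemma order_ge_ucm i : order_ge 1 << (ucm i : {cmonom I}) >>.
Proof.
move=> p p1; rewrite mcoeffU; case: eqP => // e.
by rewrite -e mdegU in p1.
Qed.

Lemma order_ge_trans k (a b c d e : {malg R[{cmonom I}]}) :
  order_ge k (a - c * b) -> order_ge k (b - d * e) -> order_ge k (a - c * d * e).
Proof.
move=> h1 h2; have -> : a - c * d * e = (a - c * b) + c * (b - d * e) by ring.
by apply: order_geD => //; apply: order_geMl.
Qed.
End Order.

Lemma mcoeff_subZ (R : comNzRingType) (K : choiceType) (c : R) (v w : {malg R[K]}) k :
  (v - c *: w)@_k = v@_k - c * w@_k.
Proof. by rewrite mcoeffB mcoeffZ. Qed.

Section Vanish.
Context (R : comNzRingType) (I K : choiceType).
Implicit Types v w : {malg {malg R[{cmonom I}]}[K]}.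

Definition vanish k v := forall la, order_ge k v@_la.

Lemma vanish_trans k c d v w z :
  vanish k (v - c *: w) -> vanish k (w - d *: z) -> vanish k (v - (c * d) *: z).
Proof.
move=> h1 h2 la; have {}h1 := h1 la; have {}h2 := h2 la.
rewrite mcoeff_subZ in h1; rewrite mcoeff_subZ in h2; rewrite mcoeff_subZ.
exact: order_ge_trans h1 h2.
Qed.

Lemma vanish_refl k v : vanish k (v - 1 *: v).
Proof. by move=> la; rewrite scale1r subrr mcoeff0; apply: order_ge0. Qed.
End Vanish.

Lemma linear_vanish k (T : Pmod -> Pmod) (v : Pmod) : linear T -> vanish k v -> vanish k (T v).
Proof.
move=> lT hv nu; rewrite (linear_coef _ _ lT).
by apply: order_ge_sum => la; apply: order_geMr.
Qed.

Lemma linear_vanishB k (T : Pmod -> Pmod) (c : pol) (v w : Pmod) : linear T ->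
  vanish k (v - c *: w) -> vanish k (T v - c *: T w).
Proof.
by move=> lT h; rewrite -(linear_opZ lT) -(linear_opB lT); apply: linear_vanish.
Qed.

Definition width_filtered M (v : Pmod) := forall la, order_ge (width la - M) v@_la.

Lemma basis_filtered la : width_filtered (width la) (basis la).
Proof.
move=> mu; rewrite basis_coef; case: (la =P mu) => [->|_].
  by rewrite subnn; apply: order_ge_trivial.
exact: order_ge0.
Qed.

(** An added box widens a partition by at most one column and brings a factor [x]. *)
Lemma A_factor_filtered M x k v : order_ge 1 x ->
  width_filtered M v -> width_filtered M (A_factor x k.+1 v).
Proof.
move=> hx hv nu; rewrite A_factor_coef; apply: order_geD; first exact: hv.
case E: (rem_box _ _) => [ka|] /=; last by rewrite mulr0; apply: order_ge0.
rewrite mulrBr; apply: order_geB.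
  have /rem_add_box/width_add_box wd := E.
  apply: (@order_ge_le _ _ (1 + (width ka - M))); first by lia.
  by apply: order_geM.
by rewrite mulrA; apply: order_geMl; apply: hv.
Qed.

Lemma A_trunc_filtered M N x v : order_ge 1 x ->
  width_filtered M v -> width_filtered M (A_trunc N x v).
Proof.
move=> hx hv; elim: N => [//|N IH]; rewrite A_truncS; exact: A_factor_filtered.
Qed.

(** Column [width la] would have to grow from height 0, whereas [B] only lowers columns. *)
Lemma B_trunc_coef_width N y la nu : (width la < width nu)%N ->
  (B_trunc N y (basis la))@_nu = 0.
Proof.
move=> lt; have la0 : col la (width la) = 0%N by apply: col_width0.
have nu0 : (0 < col nu (width la))%N by rewrite lt0n col_eq0 -ltnNge.
case: (pselect (forall i, (N <= i)%N -> col la i = col nu i)) => [ag|].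
  rewrite (B_trunc_coef _ ag).
  have wN : (width la < N)%N by rewrite ltnNge; apply/negP => /ag; lia.
  by rewrite (bigD1 (Ordinal wN)) //= la0 wdown_lt // mul0r.
case/asboolPn/existsp_asboolPn => i /asboolPn/imply_asboolPn [iN /eqP ne].
exact: B_trunc_coef_off iN ne.
Qed.

Lemma B_trunc_filtered M N y v :
  width_filtered M v -> width_filtered M (B_trunc N y v).
Proof.
move=> hv nu; rewrite (linear_coef _ _ (@B_trunc_linear N y)).
apply: order_ge_sum => la; case: (ltnP (width la) (width nu)) => h.
  by rewrite B_trunc_coef_width // mulr0; apply: order_ge0.
by apply: order_geMr; apply: order_ge_le (hv la); lia.
Qed.

Lemma sub_scale_linear (R : comNzRingType) (V : lmodType R) (c d : R) (v w v' w' : V) :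
  c *: v + w - d *: (c *: v' + w') = c *: (v - d *: v') + (w - d *: w').
Proof.
rewrite scalerDr scalerBr !scalerA (mulrC d c) opprD.
by rewrite !addrA; congr (_ - _); rewrite addrAC.
Qed.

Lemma A_B_trunc_vanish M N x y v : order_ge 1 x -> width_filtered M v ->
  vanish (N - M) (A_trunc N x (B_trunc N y v)
                  - (1 - x * y) *: B_trunc N y (A_trunc N x v)).
Proof.
move=> hx hv nu; case: (ltnP N (width nu)) => Nnu.
  (* For [nu] wider than [N] the filtration already gives both terms order above [N - M]; a source
     [la] wider than [N] is handled likewise below. *)
  rewrite mcoeff_subZ; apply: (@order_ge_le _ _ (width nu - M)); first by lia.
  apply: order_geB; last apply: order_geMl.
    by apply: A_trunc_filtered => //; apply: B_trunc_filtered.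
  by apply: B_trunc_filtered; apply: A_trunc_filtered.
pose T w := A_trunc N x (B_trunc N y w) - (1 - x * y) *: B_trunc N y (A_trunc N x w).
have lT : linear T.
  move=> c w z; rewrite /T.
  rewrite (A_trunc_linear N x c w z) (B_trunc_linear N y c w z).
  rewrite (A_trunc_linear N x c (B_trunc N y w)) (B_trunc_linear N y c (A_trunc N x w)).
  exact: sub_scale_linear.
rewrite -/(T v) (linear_coef _ _ lT); apply: order_ge_sum => la.
case: (ltnP N (width la)) => Nla.
  by apply: order_geMr; apply: order_ge_le (hv la); lia.
rewrite mcoeff_subZ.
have [q ->] := A_B_trunc_commute x y Nla Nnu.
(* The first summand is the order of the coefficient of [v], the second that of the commutation
   error on [la]. *)
apply: (@order_ge_le _ _ ((width la - M) + (N - width la))); first by lia.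
by apply: order_geM; [exact: hv | apply: order_geMr; apply: order_geX].
Qed.

Section ManyVariables.
Context (N : nat) (xs ys : nat -> pol) (hx : forall i, order_ge 1 (xs i)).

Definition A_seq (s : seq nat) (v : Pmod) := foldl (fun w i => A_trunc N (xs i) w) v s.
Definition B_seq (s : seq nat) (v : Pmod) := foldl (fun w i => B_trunc N (ys i) w) v s.

Lemma A_seq_linear s : linear (A_seq s).
Proof. exact: (foldl_linear _ (fun i => @A_trunc_linear N (xs i))). Qed.

Lemma B_seq_linear s : linear (B_seq s).
Proof. exact: (foldl_linear _ (fun i => @B_trunc_linear N (ys i))). Qed.

Lemma A_seq_filtered M s v : width_filtered M v -> width_filtered M (A_seq s v).
Proof. by elim: s v => //= i s IH v hv; apply: IH; apply: A_trunc_filtered. Qed.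

Lemma A_seq_B_trunc_vanish M s y v : width_filtered M v ->
  vanish (N - M) (A_seq s (B_trunc N y v)
    - (\prod_(i <- s) (1 - xs i * y)) *: B_trunc N y (A_seq s v)).
Proof.
elim: s v => [|i s IH] v hv; first by rewrite big_nil; apply: vanish_refl.
rewrite big_cons; apply: (vanish_trans (w := A_seq s (B_trunc N y (A_trunc N (xs i) v)))).
  apply: (linear_vanishB (A_seq_linear s)); exact: A_B_trunc_vanish.
by apply: IH; apply: A_trunc_filtered.
Qed.

Lemma A_B_seq_vanish M s t v : width_filtered M v ->
  vanish (N - M) (A_seq s (B_seq t v)
    - (\prod_(j <- t) \prod_(i <- s) (1 - xs i * ys j)) *: B_seq t (A_seq s v)).
Proof.
elim: t v => [|j t IH] v hv; first by rewrite big_nil; apply: vanish_refl.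
rewrite big_cons mulrC; apply: (vanish_trans (w := B_seq t (A_seq s (B_trunc N (ys j) v)))).
  by apply: IH; apply: B_trunc_filtered.
apply: (linear_vanishB (B_seq_linear t)); exact: A_seq_B_trunc_vanish.
Qed.
End ManyVariables.

(** * Power series up to the divisors of a monomial *)

Definition mdvd (I : choiceType) (p m : {cmonom I}) := exists q, m = mmul p q.

Lemma mdvd_refl (I : choiceType) (m : {cmonom I}) : mdvd m m.
Proof. by exists mone; rewrite mulm1. Qed.

Lemma mdvd_mull (I : choiceType) (p q m : {cmonom I}) : mdvd (mmul p q) m -> mdvd p m.
Proof. by case=> r ->; exists (mmul q r); rewrite mulmA. Qed.

Lemma mdvd_mulr (I : choiceType) (p q m : {cmonom I}) : mdvd (mmul p q) m -> mdvd q m.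
Proof. by rewrite mulmC; apply: mdvd_mull. Qed.

Lemma mdvd_deg (I : choiceType) (p m : {cmonom I}) : mdvd p m -> (mdeg p <= mdeg m)%N.
Proof. by case=> q ->; rewrite mdegM leq_addr. Qed.

Lemma mdvd_ucm (I : choiceType) (i : I) (m : {cmonom I}) : mdvd (ucm i) m -> (0 < m i)%N.
Proof. by case=> q ->; rewrite cmM cmUU. Qed.

Section Congruence.
Context (R : comNzRingType) (I : choiceType) (m : {cmonom I}).
Implicit Types P Q : {malg R[{cmonom I}]}.

(** Equality modulo the ideal spanned by the monomials not dividing [m]. The coefficient of [m] in a
    product depends only on the factors modulo this ideal. *)
Definition cong P Q := forall p, mdvd p m -> P@_p = Q@_p.

Lemma cong_refl P : cong P P. Proof. by []. Qed.

Lemma cong_trans Q P P' : cong P Q -> cong Q P' -> cong P P'.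
Proof. by move=> h1 h2 p pm; rewrite h1 // h2. Qed.

Lemma congD P P' Q Q' : cong P P' -> cong Q Q' -> cong (P + Q) (P' + Q').
Proof. by move=> h1 h2 p pm; rewrite !mcoeffD h1 // h2. Qed.

Lemma cong0M P Q : cong P 0 -> cong (P * Q) 0.
Proof.
move=> h p pm; rewrite mcoeff0; apply/eqP; rewrite mcoeff_eq0.
apply/negP => /msuppM_le [p1 [p2 [+ _ e]]].
by rewrite e in pm; rewrite -mcoeff_neq0 (h _ (mdvd_mull pm)) mcoeff0 eqxx.
Qed.

Lemma cong_sub0 P Q : cong P Q <-> cong (P - Q) 0.
Proof.
split=> h p pm; first by rewrite mcoeffB h // subrr mcoeff0.
by apply/eqP; rewrite -subr_eq0 -mcoeffB h // mcoeff0.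
Qed.

Lemma congM P P' Q Q' : cong P P' -> cong Q Q' -> cong (P * Q) (P' * Q').
Proof.
move=> /cong_sub0 h1 /cong_sub0 h2; apply/cong_sub0.
have -> : P * Q - P' * Q' = (P - P') * Q + (Q - Q') * P' by ring.
by rewrite -[0]addr0; apply: congD; apply: cong0M.
Qed.

(** To be applied with [D] the product of the [1 - x_i y_j] and [K] the truncated Cauchy kernel. *)
Lemma cong_cancel K D P Q : cong (K * D) 1 -> cong P (D * Q) -> cong (K * P) Q.
Proof.
move=> h1 h2; have := congM h1 (@cong_refl Q); rewrite mul1r -mulrA.
by apply: cong_trans; apply: congM => //; apply: cong_refl.
Qed.

Lemma order_ge_cong k P Q : (mdeg m < k)%N -> order_ge k (P - Q) -> cong P Q.
Proof.
move=> mk h; apply/cong_sub0 => p /mdvd_deg pm; rewrite mcoeff0; apply: h; lia.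
Qed.

Lemma cong_prod (T : Type) (s : seq T) (F G : T -> {malg R[{cmonom I}]}) :
  (forall t, cong (F t) (G t)) -> cong (\prod_(t <- s) F t) (\prod_(t <- s) G t).
Proof.
move=> h; elim: s => [|t s IH]; first by rewrite !big_nil; apply: cong_refl.
by rewrite !big_cons; apply: congM.
Qed.

Lemma cong_prod1 (T : Type) (s : seq T) (F : T -> {malg R[{cmonom I}]}) :
  (forall t, cong (F t) 1) -> cong (\prod_(t <- s) F t) 1.
Proof.
move=> h; elim: s => [|t s IH]; first by rewrite big_nil; apply: cong_refl.
by rewrite big_cons; have := congM (h t) IH; rewrite mulr1.
Qed.

Lemma cong_prod_trunc n N (F : nat -> {malg R[{cmonom I}]}) :
  (n <= N)%N -> (forall i, (n <= i)%N -> cong (F i) 1) ->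
  cong (\prod_(i < N) F i) (\prod_(i < n) F i).
Proof.
move=> + h; elim: N => [|N IH]; first by rewrite leqn0 => /eqP ->.
rewrite leq_eqVlt => /orP[/eqP ->//|nN]; rewrite big_ord_recr /= -[X in cong _ X]mulr1.
by apply: congM; [apply: IH | apply: h].
Qed.

Lemma cong_ucm i : m i = 0%N -> cong << (ucm i : {cmonom I}) >> 0.
Proof.
move=> m0 p pm; rewrite mcoeffU mcoeff0; case: eqP => // e.
by rewrite -e in pm; have := mdvd_ucm pm; rewrite m0.
Qed.
End Congruence.

Definition agree (m : mon) (f : series) (P : pol) := forall p, mdvd p m -> f p = P@_p.

Lemma agree_cong m f P Q : agree m f P -> cong m P Q -> agree m f Q.
Proof. by move=> h1 h2 p pm; rewrite h1 // h2. Qed.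

Lemma agree_series_of m (P : pol) : agree m (series_of P) P.
Proof. by []. Qed.

Section SeriesSums.
Local Open Scope classical_set_scope.

(** The list [r] need not lie inside [A], which permits the full product of two supports in
    [smul_series_of]. *)
Lemma fsbig_condE (V : nmodType) (T : choiceType) (A : set T) (r : seq T) (f : T -> V) :
  uniq r -> (forall i, A i -> i \notin r -> f i = 0) ->
  \sum_(i \in A) f i = \sum_(i <- r) (if i \in A then f i else 0).
Proof.
move=> ur h; rewrite (fsbigE [seq i <- r | i \in A]).
- by rewrite big_filter_cond -big_mkcond; apply: eq_bigl => i; rewrite andbb.
- exact: filter_uniq.
- by move=> i /=; rewrite mem_filter => /andP[+ _]; rewrite inE.
- by move=> i Ai; rewrite mem_filter mem_set //=; apply: h.
Qed.

Lemma ssumE (T : choiceType) (F : T -> series) (r : seq T) m :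
  uniq r -> (forall t, t \notin r -> F t m = 0) ->
  ssum F m = \sum_(t <- r) F t m.
Proof.
move=> ur h; rewrite /ssum (fsbig_condE ur) => [|t _ /h //].
by apply: eq_bigr => t _; rewrite in_setT.
Qed.

Lemma smul_series_of (P Q : pol) m :
  smul (series_of P) (series_of Q) m = (P * Q)@_m.
Proof.
pose r := [seq (p, q) | p <- msupp P, q <- msupp Q].
rewrite /smul (@fsbig_condE _ _ _ r).
- rewrite big_allpairs mcoeffMl; apply: eq_bigr => p _; apply: eq_bigr => q _ /=.
  by rewrite /series_of; case: ifPn; rewrite ?inE ?notin_setE /= => /eqP; case: eqP.
- by apply: allpairs_uniq; [exact: fset_uniq | exact: fset_uniq | case=> ? ? [? ?]].
- move=> [p q] _ nr; rewrite /series_of /=; apply/eqP; move: nr; apply: contraNT.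
  move=> h; apply/allpairsP; exists (p, q); split=> //=; rewrite -mcoeff_neq0;
  by apply: contraNneq h => ->; rewrite ?mul0r ?mulr0.
Qed.

Lemma eq_smul f f' g g' m : (forall p, mdvd p m -> f p = f' p) ->
  (forall p, mdvd p m -> g p = g' p) -> smul f g m = smul f' g' m.
Proof.
move=> hf hg; apply: eq_fsbigr => -[p q]; rewrite inE /= => e.
have pq : mdvd (mmul p q) m by rewrite e; apply: mdvd_refl.
by rewrite hf ?hg //; [exact: mdvd_mulr pq | exact: mdvd_mull pq].
Qed.

Lemma agree_smul m f g P Q : agree m f P -> agree m g Q -> agree m (smul f g) (P * Q).
Proof.
move=> hf hg p pm; rewrite -smul_series_of; apply: eq_smul => q qp.
  by rewrite hf //; case: pm qp => r -> [s ->]; exists (mmul s r); rewrite mulmA.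
by rewrite hg //; case: pm qp => r -> [s ->]; exists (mmul s r); rewrite mulmA.
Qed.

Lemma smul0l f g m : (forall p, mdvd p m -> f p = 0) -> smul f g m = 0.
Proof.
move=> h; rewrite (@eq_smul _ (fun=> 0) _ g) //.
by rewrite /smul fsbig1 // => -[p q] _; rewrite mul0r.
Qed.

Lemma smul0r f g m : (forall p, mdvd p m -> g p = 0) -> smul f g m = 0.
Proof.
move=> h; rewrite (@eq_smul _ f _ (fun=> 0)) //.
by rewrite /smul fsbig1 // => -[p q] _; rewrite mulr0.
Qed.

Lemma evlimE (T : nmodType) (s : nat -> T) l N :
  (forall n, (N <= n)%N -> s n = l) -> evlim s = l.
Proof.
move=> h; apply: xget_unique; first by exists N.
by move=> l' [N' h']; rewrite -(h (maxn N N')) ?leq_maxl // h' ?leq_maxr.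
Qed.
End SeriesSums.

Lemma agree_geom m (P : pol) K : order_ge 1 P -> (mdeg m < K)%N ->
  agree m (geom P) (\sum_(k < K) P ^+ k).
Proof.
move=> hP mK p /mdvd_deg pm; rewrite /geom (@ssumE _ _ (iota 0 K)) ?iota_uniq //.
  rewrite raddf_sum -(big_mkord xpredT (fun k => (P ^+ k)@_p)) /index_iota subn0.
  by [].
move=> k; rewrite mem_iota /= add0n -leqNgt => Kk.
rewrite /series_of; apply: (order_geX (n := k) hP); lia.
Qed.

Lemma agree_slim m (F : nat -> series) (P : pol) N :
  (forall n, (N <= n)%N -> agree m (F n) P) -> agree m (slim F) P.
Proof.
by move=> h p pm; rewrite /slim (evlimE (l := P@_p) (N := N)) // => n /h; apply.
Qed.

Lemma agree_big_smul m (T : Type) (s : seq T) (F : T -> series) (G : T -> pol) :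
  (forall t, agree m (F t) (G t)) ->
  agree m (\big[smul/sone]_(t <- s) F t) (\prod_(t <- s) G t).
Proof.
move=> h; elim: s => [|t s IH]; first by rewrite !big_nil.
by rewrite !big_cons; apply: agree_smul.
Qed.

Lemma big_ord_iota (S : Type) (idx : S) (op : S -> S -> S) n (F : nat -> S) :
  \big[op/idx]_(i < n) F i = \big[op/idx]_(i <- iota 0 n) F i.
Proof. by rewrite -(big_mkord xpredT) /index_iota subn0. Qed.

(** * The Cauchy kernel up to the divisors of a monomial *)

Section GeometricSum.
Context (R : comNzRingType) (I : choiceType) (m : {cmonom I}).
Implicit Types P : {malg R[{cmonom I}]}.

Lemma cong_geom_sum1 K P : cong m P 0 -> cong m (\sum_(k < K.+1) P ^+ k) 1.
Proof.
move=> h; rewrite big_ord_recl expr0 -[X in cong m _ X]addr0.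
apply: congD; first exact: cong_refl.
under eq_bigr => k _ do rewrite exprS.
by rewrite -mulr_sumr; apply: cong0M.
Qed.

Lemma cong_geom_sumM K P : order_ge 1 P -> (mdeg m < K)%N ->
  cong m ((\sum_(k < K) P ^+ k) * (1 - P)) 1.
Proof.
move=> hP mK; apply: (order_ge_cong mK).
have -> : (\sum_(k < K) P ^+ k) * (1 - P) - 1 = - P ^+ K.
  have -> : (\sum_(k < K) P ^+ k) * (1 - P) = - ((P - 1) * \sum_(k < K) P ^+ k) by ring.
  by rewrite -subrX1; ring.
by apply: order_geN; apply: order_geX.
Qed.
End GeometricSum.

Section Kernel.
Context (m : mon) (n : nat).
Context (hn : forall i, (n <= i)%N -> m (inl i) = 0%N /\ m (inr i) = 0%N).

(** Powers of [xvar i * yvar j] beyond [mdeg m] have no monomial dividing [m], so the geometric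
    series may stop there. *)
Definition kernel_trunc : pol :=
  \prod_(i < n) \prod_(j < n) \sum_(k < (mdeg m).+1) (xvar i * yvar j) ^+ k.

Lemma order_ge_xy i j : order_ge 1 (xvar i * yvar j).
Proof. by apply: order_geMr; apply: order_ge_ucm. Qed.

Lemma cong_x i : (n <= i)%N -> cong m (xvar i) 0.
Proof. by move=> /hn[h _]; apply: cong_ucm. Qed.

Lemma cong_y i : (n <= i)%N -> cong m (yvar i) 0.
Proof. by move=> /hn[_ h]; apply: cong_ucm. Qed.

(** The variables of index at least [n] do not divide [m], so every factor containing one of them is
    congruent to 1. *)
Lemma agree_kernel : agree m cauchy_kernel kernel_trunc.
Proof.
apply: (agree_slim (N := n)) => N nN.
apply: agree_cong.
  apply: agree_big_smul => i; apply: agree_big_smul => j.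
  apply: (agree_geom (K := (mdeg m).+1)) => //; exact: order_ge_xy.
apply: cong_trans.
  apply: cong_prod => i.
  apply: (cong_prod_trunc
    (F := fun j => \sum_(k < (mdeg m).+1) (xvar i * yvar j) ^+ k) nN) => j nj.
  by apply: cong_geom_sum1; rewrite mulrC; apply: cong0M; apply: cong_y.
pose F i := \prod_(j < n) \sum_(k < (mdeg m).+1) (xvar i * yvar j) ^+ k.
apply: (cong_prod_trunc (F := F) nN) => i ni.
apply: cong_prod1 => j.
by apply: cong_geom_sum1; apply: cong0M; apply: cong_x.
Qed.

Lemma kernel_truncM : cong m (kernel_trunc *
  \prod_(j <- iota 0 n) \prod_(i <- iota 0 n) (1 - xvar i * yvar j)) 1.
Proof.
pose F i := \prod_(j <- iota 0 n) (1 - xvar i * yvar j).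
rewrite exchange_big /= -(big_ord_iota _ _ n F).
rewrite /kernel_trunc -big_split; apply: cong_prod1 => i.
rewrite /F -(big_ord_iota _ _ n (fun j => 1 - xvar i * yvar j)) /= -big_split.
apply: cong_prod1 => j; apply: cong_geom_sumM => //; exact: order_ge_xy.
Qed.
End Kernel.

(** * Independence of the truncation bound *)

Section Stability.

Definition eq_narrow W (v w : Pmod) := forall la, (width la <= W)%N -> v@_la = w@_la.

Lemma A_factor_eq_narrow W x k v w :
  eq_narrow W v w -> eq_narrow W (A_factor x k.+1 v) (A_factor x k.+1 w).
Proof.
move=> h la laW; apply: (etrans (A_factor_coef x k v la)).
apply: (etrans _ (esym (A_factor_coef x k w la))).
case E: (rem_box _ _) => [ka|]; last by rewrite (h la laW).
have kaW : (width ka <= W)%N by have /rem_add_box/width_add_box := E; lia.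
by rewrite /= (h la laW) (h ka kaW).
Qed.

Lemma A_factor_narrow W x k v : (W <= k)%N -> eq_narrow W (A_factor x k.+1 v) v.
Proof.
move=> Wk la laW; rewrite A_factor_coef.
have -> : rem_box k.+1 la = None by apply/rem_box_None; rewrite !col_width0 //; lia.
by rewrite mulr0 addr0.
Qed.

(** A factor acting in a column beyond [W] changes a coefficient only at partitions with a cell in
    that column. *)
Lemma A_trunc_narrow W N x v : (W <= N)%N -> eq_narrow W (A_trunc N x v) (A_trunc W x v).
Proof.
elim: N => [|N IH]; first by rewrite leqn0 => /eqP ->.
rewrite leq_eqVlt ltnS => /orP[/eqP -> //|WN] la laW.
by rewrite A_truncS (A_factor_narrow x _ WN laW) (IH WN la laW).
Qed.

Lemma A_trunc_eq_narrow W N x v w :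
  eq_narrow W v w -> eq_narrow W (A_trunc N x v) (A_trunc N x w).
Proof.
move=> h; elim: N => [//|N IH] la laW.
apply: (etrans (congr1 (mcoeff la) (A_truncS N x v))).
apply: (etrans _ (esym (congr1 (mcoeff la) (A_truncS N x w)))).
exact: A_factor_eq_narrow IH la laW.
Qed.

Lemma A_seq_eq_narrow W N N' xs s v w : (W <= N)%N -> (W <= N')%N ->
  eq_narrow W v w -> eq_narrow W (A_seq N xs s v) (A_seq N' xs s w).
Proof.
move=> WN WN'; elim: s v w => // i s IH v w h; apply: IH => la laW.
apply: (etrans (A_trunc_narrow _ _ WN laW)).
apply: (etrans _ (esym (A_trunc_narrow _ _ WN' laW))).
exact: A_trunc_eq_narrow h la laW.
Qed.

Lemma G_finE n N z la mu : (width la <= N)%N ->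
  G_fin n z la mu = (A_seq N z (iota 0 n) (basis mu))@_la.
Proof.
move=> laN; apply: (evlimE (N := N)) => N' NN'.
by apply: (@A_seq_eq_narrow (width la)) => //; apply: leq_trans NN'.
Qed.

Definition narrow W (v : Pmod) := forall la, (W < width la)%N -> v@_la = 0.

Lemma basis_narrow la : narrow (width la) (basis la).
Proof. by move=> mu; rewrite basis_coef; case: eqP => // ->; rewrite ltnn. Qed.

Lemma B_factor_narrow W y k v : (W <= k)%N -> narrow W v -> B_factor y k.+1 v = v.
Proof.
move=> Wk h; rewrite /B_factor /dt_op /linext big_seq big1 ?scaler0 ?addr0 // => la.
rewrite -mcoeff_neq0 => la_v; rewrite big_geq ?scaler0 // ltnS -/(col la k) col_width0 //.
apply: leq_trans Wk; rewrite leqNgt; apply/negP => /h e.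
by rewrite e eqxx in la_v.
Qed.

(** For [B] the whole vectors agree, since there is nothing to remove from the columns beyond
    [W]. *)
Lemma B_trunc_narrow_eq W N y v : (W <= N)%N -> narrow W v -> B_trunc N y v = B_trunc W y v.
Proof.
move=> + h; elim: N => [|N IH]; first by rewrite leqn0 => /eqP ->.
rewrite leq_eqVlt ltnS => /orP[/eqP -> //|WN].
by rewrite B_truncS (B_factor_narrow _ WN h) IH.
Qed.

Lemma B_trunc_narrow W N y v : narrow W v -> narrow W (B_trunc N y v).
Proof.
move=> h nu Wnu; rewrite (linear_coef _ _ (@B_trunc_linear N y)) big1 // => la _.
case: (ltnP W (width la)) => [/h ->|laW]; first by rewrite mul0r.
by rewrite B_trunc_coef_width ?mulr0 //; lia.
Qed.

Lemma B_seq_narrow W N ys s v : narrow W v -> narrow W (B_seq N ys s v).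
Proof. by elim: s v => // i s IH v h; apply: IH; apply: B_trunc_narrow. Qed.

Lemma B_seq_narrow_eq W N ys s v : (W <= N)%N -> narrow W v ->
  B_seq N ys s v = B_seq W ys s v.
Proof.
move=> WN; elim: s v => // i s IH v h.
rewrite -[LHS]/(B_seq N ys s (B_trunc N (ys i) v)) (B_trunc_narrow_eq _ WN h).
by rewrite IH //; apply: B_trunc_narrow.
Qed.

Lemma g_finE n N z la nu : (width la <= N)%N ->
  g_fin n z la nu = (B_seq N z (iota 0 n) (basis la))@_nu.
Proof.
move=> laN; apply: (evlimE (N := N)) => N' NN'.
congr (_ @_ nu); rewrite (B_seq_narrow_eq _ _ laN (@basis_narrow la)).
exact: B_seq_narrow_eq (leq_trans laN NN') (@basis_narrow la).
Qed.
End Stability.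

(** * Restriction to finitely many variables *)

Section DropVariables.
Context (m : mon).

Definition congv (v w : Pmod) := forall la, cong m v@_la w@_la.

Lemma congv_trans w v v' : congv v w -> congv w v' -> congv v v'.
Proof. by move=> h1 h2 la; apply: cong_trans (h1 la) (h2 la). Qed.

Lemma congv_factor (x : pol) (v w : Pmod) : cong m x 0 -> congv (v + x *: w) v.
Proof.
move=> hx la; rewrite mcoeffD mcoeffZ -[X in cong m _ X]addr0.
by apply: congD; [exact: cong_refl | exact: cong0M].
Qed.

Lemma congv_A_trunc N x v : cong m x 0 -> congv (A_trunc N x v) v.
Proof.
move=> hx; elim: N => [la|N IH]; first exact: cong_refl.
by rewrite A_truncS; apply: congv_trans IH; apply: congv_factor.
Qed.

Lemma congv_B_trunc N y v : cong m y 0 -> congv (B_trunc N y v) v.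
Proof.
move=> hy; elim: N v => [v la|N IH v]; first exact: cong_refl.
by rewrite B_truncS; apply: congv_trans (IH _) _; apply: congv_factor.
Qed.

Lemma congv_A_seq N xs s v : (forall i, i \in s -> cong m (xs i) 0) ->
  congv (A_seq N xs s v) v.
Proof.
elim: s v => [v _ la|i s IH v h]; first exact: cong_refl.
apply: congv_trans (IH _ _) (congv_A_trunc _ _ _) => [j js|]; apply: h.
  by rewrite in_cons js orbT.
exact: mem_head.
Qed.

Lemma congv_B_seq N ys s v : (forall i, i \in s -> cong m (ys i) 0) ->
  congv (B_seq N ys s v) v.
Proof.
elim: s v => [v _ la|i s IH v h]; first exact: cong_refl.
apply: congv_trans (IH _ _) (congv_B_trunc _ _ _) => [j js|]; apply: h.
  by rewrite in_cons js orbT.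
exact: mem_head.
Qed.

Context (n : nat).
Context (hn : forall i, (n <= i)%N -> m (inl i) = 0%N /\ m (inr i) = 0%N).

(** The bound [N] does not depend on [la], so that one truncation serves all terms of the sum over
    [la]. *)
Lemma agree_G_sym N la mu : (mdeg m + width mu < N)%N ->
  agree m (G_sym xvar la mu) (A_seq N xvar (iota 0 n) (basis mu))@_la.
Proof.
move=> mN; apply: (agree_slim (N := n)) => n' nn'.
rewrite (@G_finE n' (maxn N (width la))) ?leq_maxr //.
apply: agree_cong; first exact: agree_series_of.
apply: (cong_trans (Q := (A_seq (maxn N (width la)) xvar (iota 0 n) (basis mu))@_la)).
  rewrite -(subnKC nn') iotaD /A_seq foldl_cat.
  apply: congv_A_seq => i; rewrite mem_iota => /andP[ni _]; exact: (cong_x hn).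
case: (leqP (width la) N) => laN; first exact: cong_refl.
(* For [la] wider than [N] the two truncations may differ, but both coefficients have order above
   [mdeg m]. *)
apply: (@order_ge_cong _ _ _ (width la - width mu)); first by lia.
have filt N' : order_ge (width la - width mu) (A_seq N' xvar (iota 0 n) (basis mu))@_la.
  by apply: A_seq_filtered; [move=> i; apply: order_ge_ucm | exact: basis_filtered].
exact: order_geB.
Qed.

Lemma agree_g_sym N la nu : (width la <= N)%N ->
  agree m (g_sym yvar la nu) (B_seq N yvar (iota 0 n) (basis la))@_nu.
Proof.
move=> laN; apply: (agree_slim (N := n)) => n' nn'.
rewrite (g_finE n' _ _ laN).
apply: agree_cong; first exact: agree_series_of.
rewrite -(subnKC nn') iotaD /B_seq foldl_cat.
apply: congv_B_seq => i; rewrite mem_iota => /andP[ni _]; exact: (cong_y hn).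
Qed.
End DropVariables.

(** * Comparison of the coefficients of one monomial *)

Lemma mon_bound (m : mon) :
  exists n, forall i, (n <= i)%N -> m (inl i) = 0%N /\ m (inr i) = 0%N.
Proof.
pose ix (t : nat + nat) := match t with inl i => i | inr i => i end.
exists (\max_(t <- finsupp m) (ix t).+1)%N => i ni.
have h t : ix t = i -> m t = 0%N.
  move=> e; apply/eqP; rewrite cmE_eq0; apply/negP => tm.
  have := @leq_bigmax_seq _ (enum_fset (finsupp m)) xpredT (fun t => (ix t).+1) t tm isT.
  by move=> le; have := leq_trans le ni; rewrite e ltnn.
by split; apply: h.
Qed.

Theorem theorem5p1 (mu nu : part) :
  ssum (fun la : part => smul (G_sym xvar la mu) (g_sym yvar la nu))
  = smul cauchy_kernel
      (ssum (fun ka : part => smul (G_sym xvar nu ka) (g_sym yvar mu ka))).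
Proof.
apply: funext => m; have [n hn] := mon_bound m.
(* With this choice [N - width mu] is [(mdeg m).+1], so the commutation error has no monomial
   dividing [m]. *)
pose N := (mdeg m + width mu).+1; pose s := iota 0 n.
pose v := A_seq N xvar s (basis mu); pose w := B_seq N yvar s (basis mu).
have vf : width_filtered (width mu) v.
  by apply: A_seq_filtered; [move=> i; apply: order_ge_ucm | apply: basis_filtered].
(* The sum over [la] is a matrix product: [A] first, then [B]. A partition wider than [N]
   contributes nothing at [m], by the filtration of [v]. *)
have lhs : ssum (fun la : part => smul (G_sym xvar la mu) (g_sym yvar la nu)) m
    = ((B_seq N yvar s v)@_nu)@_m.
  have Fm la : smul (G_sym xvar la mu) (g_sym yvar la nu) m
      = (v@_la * (B_seq N yvar s (basis la))@_nu)@_m.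
    have aG := @agree_G_sym m n hn N la mu (ltnSn _).
    case: (leqP (width la) N) => laN.
      by apply: (agree_smul aG (agree_g_sym hn nu laN)); apply: mdvd_refl.
    have v0 : order_ge (mdeg m).+1 v@_la by apply: order_ge_le (vf la); lia.
    rewrite smul0l => [|p pm]; first by rewrite (order_geMr _ v0).
    by rewrite aG // v0 // ltnS; apply: mdvd_deg.
  rewrite (@ssumE _ _ (msupp v)) ?fset_uniq //; last first.
    by move=> la /mcoeff_outdom e; rewrite Fm e mul0r mcoeff0.
  rewrite (linear_coef _ _ (@B_seq_linear N yvar s)) raddf_sum.
  by apply: eq_bigr => la _; rewrite Fm.
(* In the other order [B] acts first, so only [ka] no wider than [mu] occur and [N] is large enough
   for all of them. Agreement at all divisors of [m] is required because of the multiplication by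
   the kernel. *)
have rhs : agree m (ssum (fun ka : part => smul (G_sym xvar nu ka) (g_sym yvar mu ka)))
    (A_seq N xvar s w)@_nu.
  have wn : narrow (width mu) w by apply: B_seq_narrow; apply: basis_narrow.
  have muN : (width mu <= N)%N by rewrite /N; lia.
  have Fp p ka : mdvd p m -> smul (G_sym xvar nu ka) (g_sym yvar mu ka) p
      = (w@_ka * (A_seq N xvar s (basis ka))@_nu)@_p.
    move=> pm; have ag := @agree_g_sym m n hn N mu ka muN.
    case: (leqP (width ka) (width mu)) => kamu.
      rewrite mulrC; apply: agree_smul pm => //.
      by apply: agree_G_sym => //; rewrite /N; lia.
    rewrite wn // mul0r mcoeff0 smul0r // => q qp.
    rewrite ag -/w; first by rewrite -/s -/w wn // mcoeff0.
    by case: pm qp => r -> [t ->]; exists (mmul t r); rewrite mulmA.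
  move=> p pm; rewrite (@ssumE _ _ (msupp w)) ?fset_uniq //; last first.
    by move=> ka /mcoeff_outdom e; rewrite Fp // e mul0r mcoeff0.
  rewrite (linear_coef _ _ (@A_seq_linear N xvar s)) raddf_sum.
  by apply: eq_bigr => ka _; rewrite Fp.
rewrite lhs (agree_smul (agree_kernel hn) rhs (mdvd_refl m)).
pose D : pol := \prod_(j <- s) \prod_(i <- s) (1 - xvar i * yvar j).
have van : vanish (N - width mu) (A_seq N xvar s w - D *: B_seq N yvar s v).
  by apply: A_B_seq_vanish; [move=> i; apply: order_ge_ucm | exact: basis_filtered].
have comm : cong m (A_seq N xvar s w)@_nu (D * (B_seq N yvar s v)@_nu).
  apply: (@order_ge_cong _ _ _ (N - width mu)); first by rewrite /N; lia.
  by have := van nu; rewrite mcoeff_subZ.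
apply/esym; apply: (cong_cancel (@kernel_truncM m n) comm).
exact: mdvd_refl.
Qed.
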